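(* Let $\mathbf{B}$ be the unit disk of a norm on $\mathbb{R}^2$ that is not angled, and let $C$ be an $m$-sided Reuleaux polygon of diameter one in this norm. Then: \begin{enumerate} \item $m$ is an odd integer; \item if $m=2s+1$, then for every positive integer $k$ the $k$-fold Borsuk number of $C$ is $a_k(C)=2k+\left\lceil\frac{k}{s}\right\rceil$. \end{enumerate}
   Context: A normed plane is $\mathbb{R}^2$ equipped with a norm, with closed unit ball (unit disk) $\mathbf{B}$ and unit circle $\mathbb{S}=\operatorname{bd}\mathbf{B}$; diameters are taken with respect to this norm. The plane (norm) is angled if for some non-collinear points $a,b,c$ we have $[a,b]\cup[b,c]\subset\mathbb{S}$. A bounded set $C$ is complete if no set of the same diameter properly contains $C$. A complete set $C$ of diameter one is a Reuleaux polygon if it is the intersection of finitely many translates of $\mathbf{B}$; if $m$ is the smallest number such that $C$ is the intersection of $m$ translates of $\mathbf{B}$, then $C$ is said to have $m$ sides ($C$ is $m$-sided). For a set $S$ of diameter $d>0$, the $k$-fold Borsuk number $a_k(S)$ is the smallest cardinality of an (indexed) family $\mathcal{F}$ of subsets of $S$, each of diameter strictly less than $d$, such that every point of $S$ belongs to at least $k$ members of $\mathcal{F}$. *)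

(* Defs.v *)
From mathcomp Require Import all_boot all_order all_algebra.
From mathcomp Require Import all_classical all_reals all_analysis.
Import Order.TTheory GRing.Theory Num.Theory.
Import numFieldNormedType.Exports.

Set Implicit Arguments.
Unset Strict Implicit.
Unset Printing Implicit Defensive.

Local Open Scope classical_set_scope.
Local Open Scope ring_scope.

Record is_norm (R : realType) (N : 'rV[R]_2 -> R) : Prop := IsNorm {
  is_norm_triangle : forall x y, N (x + y) <= N x + N y ;
  is_norm_homogeneous : forall a x, N (a *: x) = `|a| * N x ;
  is_norm_definite : forall x, N x = 0 -> x = 0 }.

Section NormedPlane.
Variables (R : realType) (N : 'rV[R]_2 -> R).
Implicit Types (a b c p v t : 'rV[R]_2) (C D S : set 'rV[R]_2) (k m n : nat).

Definition unit_disk : set 'rV[R]_2 := closed_ball_ N 0 1.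

(** The boundary is taken in the canonical topology of ['rV[R]_2], which all
    norms on the plane induce. *)
Definition unit_circle : set 'rV[R]_2 :=
  closure unit_disk `\` interior unit_disk.

Definition segment a b : set 'rV[R]_2 :=
  [set (1 - l) *: a + l *: b | l in `[0, 1]].

Definition collinear a b c : Prop :=
  exists p v, [/\ v != 0, exists l : R, a = p + l *: v,
                  exists l : R, b = p + l *: v
                & exists l : R, c = p + l *: v].

Definition angled : Prop :=
  exists a b c, ~ collinear a b c /\
    segment a b `|` segment b c `<=` unit_circle.

(** The diameter is extended-real-valued; the [maxe 0] gives the empty set
    diameter [0] instead of [-oo]. *)
Definition diameter S : \bar R :=
  maxe 0%E (ereal_sup [set (N (x - y))%:E | x in S & y in S]).

Definition complete_set C : Prop :=
  (diameter C < +oo)%E /\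
  forall D, diameter D = diameter C -> ~ C `<` D.

Definition translate t S : set 'rV[R]_2 := [set t + x | x in S].

(** For [n = 0] the intersection is the whole plane. *)
Definition disk_intersection n C : Prop :=
  exists t : 'I_n -> 'rV[R]_2,
    C = \bigcap_(i in [set: 'I_n]) translate (t i) unit_disk.

Definition reuleaux_polygon C : Prop :=
  [/\ complete_set C, diameter C = 1%:E & exists n, disk_intersection n C].

Definition least (P : nat -> Prop) n : Prop :=
  P n /\ forall n', P n' -> (n <= n')%N.

Definition sided_reuleaux_polygon m C : Prop :=
  reuleaux_polygon C /\ least (fun n => disk_intersection n C) m.

Definition kfold_borsuk_family k S n (F : 'I_n -> set 'rV[R]_2) : Prop :=
  (forall i, F i `<=` S /\ (diameter (F i) < diameter S)%E) /\
  (forall x, S x -> (k <= #|[pred i | x \in F i]|)%N).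

(** [kfold_borsuk_number k S n] reads [a_k(S) = n]; it is a relation because a
    set need not have a finite such family. *)
Definition kfold_borsuk_number k S n : Prop :=
  least (fun n' => exists F : 'I_n' -> set 'rV[R]_2,
                     kfold_borsuk_family k S F) n.

End NormedPlane.

(* Main.v *)
(** The [m] centers [t i] lie in [C], and irredundancy gives each of them a private
    point [q i] of [C], at distance 1 from [t i] and less than 1 from the other
    centers. Two diametral chords of [C] cross unless their directions lie in a common
    face of the unit disk, and for a norm that is not angled this exceptional relation
    is an equivalence relation on unit vectors. Therefore each center has exactly one
    diametral neighbor among the centers on either side of its chord [t i, q i]. The
    left neighbor [r i] defines a permutation; since the chords [t j, t (r j)] cross
    every chord [t i, q i] that they do not touch, [r] is a single cycle, of odd length
    [m = 2 s + 1].

    A set of diameter less than 1 contains no two consecutive centers of this cycle,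
    hence at most [s] centers: this is the lower bound. For the upper bound, the points
    weakly to the right of chord [i] and to the left of chord [r i] include no pair at
    distance 1, provided the private points are chosen in sufficiently general
    position. An endpoint of a diametral chord sees the chords [i, r i, r (r i), ...]
    alternately on its two sides, with one exception per period, so that
    [2 k + c] consecutive pieces contain it at least [k] times as soon as
    [k <= c * s]. A compactness argument extends the pieces to all of [C]. *)

Require Import Defs.
From mathcomp Require Import all_boot all_order all_algebra.
From mathcomp Require Import all_classical all_reals all_analysis.
From mathcomp Require Import ring lra zify.
Import Order.TTheory GRing.Theory Num.Theory.
Import numFieldNormedType.Exports.

Set Implicit Arguments.
Unset Strict Implicit.
Unset Printing Implicit Defensive.

Local Open Scope classical_set_scope.
Local Open Scope ring_scope.

(** * Signed area and linear dependence in the plane *)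

Section Cross.
Variable R : realType.
Implicit Types (x y z u v w a b : 'rV[R]_2) (sg : R).

(* Signed area scaled by [sg]; a lemma proved for every [sg != 0] holds, at [- sg],
   for the mirror image of the configuration. *)
Definition cr sg x y : R :=
  sg * (x ord0 ord0 * y ord0 ord_max - x ord0 ord_max * y ord0 ord0).

Lemma row2P x y :
  x ord0 ord0 = y ord0 ord0 -> x ord0 ord_max = y ord0 ord_max -> x = y.
Proof.
move=> h0 h1; apply/rowP => i.
have [->//|i0] := eqVneq i ord0.
suff -> : i = ord_max by [].
by apply/val_inj; case: i i0 => -[|[|//]].
Qed.

Lemma crC sg x y : cr sg y x = - cr sg x y.
Proof. by rewrite /cr; ring. Qed.

Lemma crN sg x y : cr (- sg) x y = - cr sg x y.
Proof. by rewrite /cr; ring. Qed.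

Lemma crxx sg x : cr sg x x = 0.
Proof. by rewrite /cr; ring. Qed.

Lemma crDr sg x y z : cr sg x (y + z) = cr sg x y + cr sg x z.
Proof. by rewrite /cr !mxE; ring. Qed.

Lemma crDl sg x y z : cr sg (y + z) x = cr sg y x + cr sg z x.
Proof. by rewrite /cr !mxE; ring. Qed.

Lemma crZr sg k x y : cr sg x (k *: y) = k * cr sg x y.
Proof. by rewrite /cr !mxE; ring. Qed.

Lemma crZl sg k x y : cr sg (k *: x) y = k * cr sg x y.
Proof. by rewrite /cr !mxE; ring. Qed.

Lemma crNr sg x y : cr sg x (- y) = - cr sg x y.
Proof. by rewrite /cr !mxE; ring. Qed.

Lemma crNl sg x y : cr sg (- x) y = - cr sg x y.
Proof. by rewrite /cr !mxE; ring. Qed.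

Lemma crBr sg x y z : cr sg x (y - z) = cr sg x y - cr sg x z.
Proof. by rewrite crDr crNr. Qed.

Definition crE := (crDr, crDl, crNr, crNl, crZr, crZl, crxx).

(** Cramer's rule in the basis [a], [b]. *)
Lemma cr_decomp sg a b x : cr sg a b != 0 ->
  x = (cr sg x b / cr sg a b) *: a + (cr sg a x / cr sg a b) *: b.
Proof.
move=> ab; have sg0 : sg != 0 by apply: contra_neq ab => ->; rewrite /cr mul0r.
have ab1 : a ord0 ord0 * b ord0 ord_max - a ord0 ord_max * b ord0 ord0 != 0.
  by apply: contra_neq ab => e; rewrite /cr e mulr0.
by apply: row2P; rewrite !mxE /cr; field; rewrite ab1 sg0.
Qed.

Lemma cr_parallel sg a x : sg != 0 -> a != 0 -> cr sg a x = 0 ->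
  exists k, x = k *: a.
Proof.
move=> sg0 a0 /eqP; rewrite mulf_eq0 (negbTE sg0) /= subr_eq0 => /eqP e.
have [a00|a00] := eqVneq (a ord0 ord0) 0.
  have a01 : a ord0 ord_max != 0.
    by apply: contra_neq a0 => a01; apply: row2P; rewrite mxE.
  exists (x ord0 ord_max / a ord0 ord_max); apply: row2P; rewrite !mxE.
    move: e; rewrite a00 mul0r mulr0 => /esym/eqP.
    by rewrite mulf_eq0 (negbTE a01) /= => /eqP.
  by rewrite divfK.
exists (x ord0 ord0 / a ord0 ord0); apply: row2P; rewrite !mxE; first by rewrite divfK.
by rewrite mulrAC -[x ord0 ord0 * _]mulrC -e mulrC mulKf.
Qed.

End Cross.

Ltac vec := apply/rowP => ?; rewrite !mxE.

(** * Inequalities between unit vectors at distance at most 1 *)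

Section Norm.
Variables (R : realType) (N : 'rV[R]_2 -> R).
Hypothesis normN : is_norm N.
Implicit Types (x y z u v w a b p h g o t : 'rV[R]_2) (sg : R).

Lemma nrmD x y : N (x + y) <= N x + N y. Proof. by case: normN. Qed.
Lemma nrmZ k x : N (k *: x) = `|k| * N x. Proof. by case: normN. Qed.
Lemma nrm0_eq0 x : N x = 0 -> x = 0. Proof. by case: normN => _ _; apply. Qed.

Lemma nrm0 : N 0 = 0.
Proof. by rewrite -(scale0r 0) nrmZ normr0 mul0r. Qed.

Lemma nrmN x : N (- x) = N x.
Proof. by rewrite -scaleN1r nrmZ normrN1 mul1r. Qed.

Lemma nrmC x y : N (x - y) = N (y - x).
Proof. by rewrite -nrmN opprB. Qed.

Lemma nrm_ge0 x : 0 <= N x.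
Proof. by have := nrmD x (- x); rewrite subrr nrm0 nrmN; lra. Qed.

Lemma nrmZp k x : 0 <= k -> N (k *: x) = k * N x.
Proof. by move=> k0; rewrite nrmZ ger0_norm. Qed.

Lemma nrm_gt0 x : x != 0 -> 0 < N x.
Proof.
by move=> x0; rewrite lt_def nrm_ge0 andbT; apply: contra_neq x0; exact: nrm0_eq0.
Qed.

Lemma unit_neq0 x : N x = 1 -> x != 0.
Proof. by move=> Nx; apply/eqP => x0; move: Nx; rewrite x0 nrm0; lra. Qed.

Lemma nrmB x y : N x - N y <= N (x - y).
Proof. by have := nrmD (x - y) y; rewrite subrK; lra. Qed.

Lemma nrm_lin k l x y : 0 <= k -> 0 <= l ->
  N (k *: x + l *: y) <= k * N x + l * N y.
Proof. by move=> k0 l0; apply: le_trans (nrmD _ _) _; rewrite !nrmZp. Qed.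

Lemma nrm_lin1 k l x y : 0 <= k -> 0 <= l -> N x <= 1 -> N y <= 1 ->
  N (k *: x + l *: y) <= k + l.
Proof. by move=> k0 l0 x1 y1; apply: le_trans (nrm_lin _ _ k0 l0) _; nra. Qed.

Lemma nrm_parallel k x y : N x = 1 -> N y = 1 -> y = k *: x -> y = x \/ y = - x.
Proof.
move=> x1 y1 e; have : `|k| = 1 by move: y1; rewrite e nrmZ x1 mulr1.
have [k0|k0] := leP 0 k; first by rewrite ger0_norm// => k1; left; rewrite e k1 scale1r.
by rewrite ltr0_norm// => k1; right; rewrite e -scaleN1r; congr (_ *: _); lra.
Qed.

Lemma cr_unit0 sg x y : sg != 0 -> N x = 1 -> N y = 1 -> cr sg x y = 0 ->
  y = x \/ y = - x.
Proof.
by move=> sg0 x1 y1 /(cr_parallel sg0 (unit_neq0 x1))[k]; exact: nrm_parallel.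
Qed.

(** Reverse triangle inequality for [(k + l) *: w - l *: (w - v)]. It bounds one coordinate by the
    norm as soon as the other coordinate is nonnegative. *)
Lemma coef_le k l w v : N w = 1 -> N (w - v) <= 1 -> 0 <= l ->
  k <= N (k *: w + l *: v).
Proof.
move=> w1 wv l0.
have -> : k *: w + l *: v = (k + l) *: w - l *: (w - v) by vec; ring.
apply: le_trans (nrmB _ _); rewrite nrmZ w1 nrmZp//.
have := ler_norm (k + l); nra.
Qed.

(** Otherwise [v] has coordinates [al <= 0] and [be < 0] in the basis [a], [b]. Then [coef_le]
    applied to [a - v] forces [al = 0], and [v], a negative multiple of [b], is at distance more
    than 1 from [b]. *)
Lemma between_le sg v a b : N a = 1 -> N v = 1 -> N (v - a) <= 1 -> N (a - b) <= 1 ->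
  N (v - b) <= 1 -> 0 < cr sg v a -> cr sg v b <= 0 -> cr sg a b <= 0.
Proof.
move=> a1 v1 va ab vb cva cvb; rewrite leNgt; apply/negP => cab.
have ev := @cr_decomp _ sg a b v (lt0r_neq0 cab).
move: ev; rewrite (crC _ b) (crC _ v a).
set al := (- cr sg b v / _); set be := (- _ / _) => ev.
have eal : al = cr sg v b / cr sg a b by rewrite /al (crC _ v b) opprK.
have al0 : al <= 0 by rewrite eal pmulr_lle0// invr_gt0.
have be0 : be < 0 by rewrite /be mulNr oppr_lt0 divr_gt0.
have : 1 - al <= 1.
  have := @coef_le (1 - al) (- be) a b a1 ab; rewrite oppr_ge0 (ltW be0) => /(_ isT).
  have -> : (1 - al) *: a + - be *: b = a - v by rewrite ev; vec; ring.
  by move=> h; apply: le_trans h _; rewrite nrmC.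
move=> al1; have al00 : al = 0 by lra.
have evb : v = be *: b by rewrite ev al00 scale0r add0r.
move: vb v1; rewrite evb -[X in _ - X]scale1r -scalerBl !nrmZ !ltr0_norm; try lra.
have := nrm_ge0 b; nra.
Qed.

Lemma between_lt sg v a b : sg != 0 ->
  N a = 1 -> N v = 1 -> N b = 1 -> N (v - a) <= 1 -> N (a - b) <= 1 ->
  N (v - b) <= 1 -> 0 < cr sg v a -> cr sg v b <= 0 -> cr sg a b < 0.
Proof.
move=> sg0 a1 v1 b1 va ab vb cva cvb.
rewrite lt_neqAle (@between_le _ v)// andbT; apply/eqP => /(cr_unit0 sg0 a1 b1)[e|e].
  by move: cvb; rewrite e leNgt cva.
by move: ab; rewrite e opprK -mulr2n -scaler_nat nrmZ a1 ger0_norm//; lra.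
Qed.

(** Write [u] as [s *: (p + u) + ta *: w] with nonnegative coefficients; since [u] is a unit vector,
    [1 <= s + ta]. This makes [p + w] a subconvex combination of [p + u] and [w] when [ta <= 1], and
    of [p + u] and [p] otherwise. *)
Lemma fan_side al be ga de u v w p : N u = 1 -> N w = 1 -> N p <= 1 ->
  N (p + u) <= 1 -> 0 <= al -> 0 < be -> w = al *: u + be *: v ->
  p = ga *: u + de *: v -> al * de <= be * ga -> de <= 0 -> N (p + w) <= 1.
Proof.
move=> u1 w1 p1 pu al0 be0 ew ep h de0.
pose d := be * (1 + ga) - al * de.
have d0 : 0 < d by rewrite /d; lra.
pose s := be / d; pose ta := - de / d.
have s0 : 0 < s by rewrite divr_gt0.
have s1 : s <= 1 by rewrite ler_pdivrMr// /d; lra.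
have ta0 : 0 <= ta by apply: divr_ge0; [lra | exact: ltW].
have eu : u = s *: (p + u) + ta *: w.
  by rewrite ew ep; vec; rewrite /s /ta /d; field; rewrite gt_eqF.
have st : 1 <= s + ta by rewrite -u1 {1}eu nrm_lin1// ?w1// ltW.
have [ta1|ta1] := leP ta 1.
  have -> : p + w = (1 - s) *: (p + u) + (1 - ta) *: w.
    have -> : p + w = p + u + w - u by vec; ring.
    by rewrite {2}eu; vec; ring.
  apply: le_trans (_ : (1 - s) + (1 - ta) <= 1); last lra.
  by apply: nrm_lin1; rewrite ?w1//; lra.
have ti0 : 0 < ta by lra.
have -> : p + w = ((1 - s) / ta) *: (p + u) + (1 - ta^-1) *: p.
  have -> : w = ta^-1 *: (u - s *: (p + u)).
    by rewrite {1}eu addrAC subrr add0r scalerA mulVf ?scale1r ?gt_eqF.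
  by vec; field; rewrite gt_eqF.
have tV : ta^-1 <= 1 by rewrite invf_le1// ltW.
apply: le_trans (_ : (1 - s) / ta + (1 - ta^-1) <= 1).
  by apply: nrm_lin1 => //; rewrite ?divr_ge0//; lra.
have -> : (1 - s) / ta + (1 - ta^-1) = 1 - s / ta by field; rewrite gt_eqF.
by rewrite lerBlDr lerDl divr_ge0// ltW.
Qed.

(** The coordinates of [p] cannot both be positive, by [coef_le]; in the other cases [fan_side]
    applies, perhaps with [u] and [v] exchanged. Consequence: the unit arc about a point of [C]
    between two points of [C] stays in [C]. *)
Lemma fan sg al be u v w p : cr sg u v != 0 -> N u = 1 -> N v = 1 -> N w = 1 ->
  N (u - v) <= 1 -> N p <= 1 -> N (p + u) <= 1 -> N (p + v) <= 1 ->
  0 < al -> 0 < be -> w = al *: u + be *: v -> N (p + w) <= 1.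
Proof.
move=> cuv u1 v1 w1 uv p1 pu pv al0 be0 ew.
have := cr_decomp p cuv; set ga := (_ / _); set de := (_ / _) => ep.
have [de0|de0] := leP de 0; have [ga0|ga0] := leP ga 0.
- have [h|h] := leP (al * de) (be * ga).
    by apply: (@fan_side al be ga de u v) => //; exact: ltW.
  by apply: (@fan_side be al de ga v u) => //; rewrite ?ltW// addrC.
- by apply: (@fan_side al be ga de u v) => //; rewrite ?ltW//; nra.
- by apply: (@fan_side be al de ga v u) => //; rewrite ?(ltW al0) ?(ltW be0)//; 
    [rewrite addrC | rewrite addrC | nra].
- have := @coef_le (1 + ga) de u v u1 uv (ltW de0).
  have -> : (1 + ga) *: u + de *: v = p + u by rewrite ep; vec; ring.
  lra.
Qed.

(** Either [h] lies in the cone of [v] and [t], or [t] lies in the cone of [v] and [h]. Both times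
    [t - h] is a subconvex combination of vectors of the disk; the bound on [N h] keeps the
    coefficient of [t] nonnegative in the first case. *)
Lemma wedge sg v t h : N v = 1 -> N t = 1 -> N (v - t) <= 1 -> N (v - h) <= 1 ->
  cr sg v h < 0 -> cr sg v t < 0 -> N h <= 2^-1 -> N (t - h) <= 1.
Proof.
move=> v1 t1 vt vh cvh cvt h2.
have [cth|cth] := leP 0 (cr sg t h).
  have := @cr_decomp _ sg v t h (ltr0_neq0 cvt).
  set c := (_ / _); set A := (_ / _) => eh.
  have c0 : 0 <= c by rewrite /c (crC _ t h) -mulrNN -invrN opprK divr_ge0// oppr_ge0 ltW.
  have A0 : 0 <= A by rewrite /A -mulrNN -invrN divr_ge0// oppr_ge0 ltW.
  have cle : c <= 2^-1 by apply: le_trans h2; rewrite eh; exact: coef_le.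
  have Ale : A <= 2^-1 by apply: le_trans h2; rewrite eh addrC; apply: coef_le; rewrite // nrmC.
  have -> : t - h = (1 - A - c) *: t + c *: (t - v) by rewrite {1}eh; vec; ring.
  apply: le_trans (_ : (1 - A - c) + c <= 1); last lra.
  by apply: nrm_lin1; rewrite ?t1// 1?nrmC//; lra.
have := @cr_decomp _ sg v h t (ltr0_neq0 cvh).
set al := (_ / _); set be := (_ / _) => et.
have al0 : 0 < al by rewrite /al -mulrNN -invrN divr_gt0// oppr_gt0.
have be0 : 0 < be by rewrite /be -mulrNN -invrN divr_gt0// oppr_gt0.
have [al1|al1] := leP al 1.
  have ab1 : 1 <= al + be.
    by rewrite -t1 {1}et; apply: nrm_lin1; rewrite ?v1//; lra.
  have abn : al + be != 0 by lra.
  have -> : t - h = (al / (al + be)) *: (v - h) + (1 - (al + be)^-1) *: t.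
    by rewrite {1}et [X in _ = _ + _ *: X]et; vec; field.
  have i1 : (al + be)^-1 <= 1 by rewrite invf_le1//; lra.
  have i0 : 0 < (al + be)^-1 by rewrite invr_gt0; lra.
  apply: le_trans (_ : al / (al + be) + (1 - (al + be)^-1) <= 1); last nra.
  apply: nrm_lin1; rewrite ?t1//; last lra.
  by rewrite divr_ge0//; lra.
exfalso; have e : (al + be) *: v = be *: (v - h) + t by rewrite et; vec; ring.
have : N ((al + be) *: v) <= be + 1.
  rewrite e -[t in X in X <= _]scale1r; apply: nrm_lin1 => //; lra.
by rewrite nrmZp ?v1; lra.
Qed.

End Norm.

(** * Faces of the unit disk and crossing unit chords *)

Section Face.
Variables (R : realType) (N : 'rV[R]_2 -> R).
Hypothesis normN : is_norm N.
Implicit Types (x y z u v w a b p h g o t : 'rV[R]_2) (sg : R).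

Lemma near_unit v u e : N v = 1 -> 0 < e ->
  exists al be, [/\ 0 < al, 0 < be, N (al *: v + be *: u) = 1
                  & N (al *: v + be *: u - v) < e].
Proof.
move=> v1 e0; pose M := N u + 1.
have M1 : 1 <= M by rewrite /M lerDr nrm_ge0.
have u0 := nrm_ge0 normN u.
(* With this [ta] the vector [ta *: u] has norm at most 1/8 and at most [e / 8], so normalizing
   [v + ta *: u] moves it less than [e] away from [v]. *)
pose ta := Num.min (8 * M)^-1 (e / (8 * M)).
have ta0 : 0 < ta by rewrite lt_min invr_gt0 divr_gt0//; lra.
have tM : ta * (8 * M) <= 1 by rewrite -ler_pdivlMr ?mul1r /ta ?ge_min ?lexx//; lra.
have te : ta * (8 * M) <= e by rewrite -ler_pdivlMr /ta ?ge_min ?lexx ?orbT//; lra.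
have tu : ta * N u <= ta * M by rewrite ler_pM2l// /M; lra.
pose w := v + ta *: u; pose n := N w.
have n1 : n <= 1 + ta * N u.
  by apply: le_trans (nrmD normN _ _) _; rewrite v1 nrmZp// ltW.
have n2 : 1 - ta * N u <= n.
  have := nrmB normN v (- (ta *: u)).
  by rewrite opprK v1 nrmN// nrmZp// ltW.
have n0 : 0 < n by nra.
have ew : n^-1 *: v + (ta / n) *: u = n^-1 *: w by rewrite /w; vec; field; rewrite gt_eqF.
exists n^-1, (ta / n); split; rewrite ?invr_gt0 ?divr_gt0//.
  by rewrite ew nrmZp// ?invr_ge0 ?ltW// mulVf// gt_eqF.
have -> : n^-1 *: v + (ta / n) *: u - v = n^-1 *: (ta *: u + (1 - n) *: v).
  by vec; field; rewrite gt_eqF.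
rewrite nrmZp// ?invr_ge0 ?ltW// ltr_pdivrMl//.
apply: le_lt_trans (nrmD normN _ _) _; rewrite !nrmZ// v1 mulr1 gtr0_norm//.
have : `|1 - n| <= ta * N u by rewrite ler_norml; lra.
nra.
Qed.

(* For unit vectors, [N (u + v) = 2] says that the segment [u, v] lies on the unit
   circle. *)
Definition same_face u v := N (u + v) = 2.

Lemma same_faceC u v : same_face u v -> same_face v u.
Proof. by rewrite /same_face addrC. Qed.

Lemma same_faceN u v : same_face (- u) (- v) -> same_face u v.
Proof. by rewrite /same_face -opprD nrmN. Qed.

Lemma same_faceB x y x' y' : same_face (x - y) (x' - y') -> same_face (y - x) (y' - x').
Proof. by move=> h; apply: same_faceN; rewrite !opprB. Qed.

Lemma same_face_refl u : N u = 1 -> same_face u u.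
Proof. by move=> u1; rewrite /same_face -mulr2n -scaler_nat nrmZ// u1 ger0_norm; lra. Qed.

(** The midpoint of [u] and [v] has norm 1 and is a convex combination of the given point and one of
    [u], [v], so that point is not inside the disk. *)
Lemma face_line u v ta : N u = 1 -> N v = 1 -> same_face u v -> 1 <= N (u + ta *: (v - u)).
Proof.
rewrite /same_face => u1 v1 uv; set x := _ + _ *: _.
have [ta2|ta2] := leP 2^-1 ta.
  have e : ta *: (u + v) = (2 * ta - 1) *: u + 1 *: x by rewrite /x; vec; field.
  have : N (ta *: (u + v)) <= (2 * ta - 1) * N u + 1 * N x.
    by rewrite e; apply: nrm_lin => //; lra.
  by rewrite nrmZp// ?uv ?u1; lra.
have e : (1 - ta) *: (u + v) = (1 - 2 * ta) *: v + 1 *: x by rewrite /x; vec; field.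
have : N ((1 - ta) *: (u + v)) <= (1 - 2 * ta) * N v + 1 * N x.
  by rewrite e; apply: nrm_lin => //; lra.
by rewrite nrmZp// ?uv ?v1; lra.
Qed.

Lemma same_face_on u v ta : N u = 1 -> N v = 1 -> same_face u v -> N (u + ta *: (v - u)) <= 1 ->
  N (u + ta *: (v - u)) = 1 /\ same_face u (u + ta *: (v - u)).
Proof.
move=> u1 v1 uv w1; have w2 := @face_line _ _ ta u1 v1 uv.
split; first by apply/eqP; rewrite eq_le w1.
have := @face_line _ _ (ta / 2) u1 v1 uv; rewrite /same_face.
have -> : u + (u + ta *: (v - u)) = 2 *: (u + (ta / 2) *: (v - u)) by vec; field.
rewrite nrmZp// => h; apply/eqP; rewrite eq_le; apply/andP; split; last lra.
have := nrmD normN u (u + ta *: (v - u)).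
have -> : u + (u + ta *: (v - u)) = 2 *: (u + (ta / 2) *: (v - u)) by vec; field.
by rewrite nrmZp// u1; lra.
Qed.

(** Expressing multiples of [v] and of [v'] through the two short vectors gives [ka <= si] and
    [si <= ka]; with equality, [v + v'] must have norm 2. *)
Lemma cross_aux v v' ka si : N v = 1 -> N v' = 1 -> 0 < ka -> 0 < si ->
  N ((1 + ka) *: v - si *: v') <= 1 -> N ((1 + si) *: v' - ka *: v) <= 1 -> same_face v v'.
Proof.
move=> v1 v1' ka0 si0; set u1 := _ - _; set u2 := _ - _ => h1 h2.
have e1 : (1 + ka + si) *: v = (1 + si) *: u1 + si *: u2 by rewrite /u1 /u2; vec; ring.
have : N ((1 + ka + si) *: v) <= (1 + si) + si by rewrite e1; apply: nrm_lin1 => //; lra.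
rewrite nrmZp// ?v1; last lra.
move=> k1.
have e2 : (1 + ka + si) *: v' = ka *: u1 + (1 + ka) *: u2 by rewrite /u1 /u2; vec; ring.
have : N ((1 + ka + si) *: v') <= ka + (1 + ka) by rewrite e2; apply: nrm_lin1 => //; lra.
rewrite nrmZp// ?v1'; last lra.
move=> k2; have ks : si = ka by lra.
have e3 : (1 + 2 * ka) *: v = ka *: (v + v') + 1 *: u1 by rewrite /u1 ks; vec; ring.
have : N ((1 + 2 * ka) *: v) <= ka * N (v + v') + 1 * N u1 by rewrite e3; apply: nrm_lin => //; lra.
rewrite nrmZp// ?v1; last lra.
move=> h; have : 2 <= N (v + v') by rewrite -(ler_pM2l ka0); lra.
have := nrmD normN v v'; rewrite /same_face v1 v1'; lra.
Qed.

(** The lines meet beyond [y]. If they meet outside the second chord too, [cross_aux] applies to one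
    of its two orientations; if they meet on it, a convex combination of [x - y'] and [x - x'] has
    norm more than 1. *)
Lemma cross_out x y x' y' s ta : N (x - y) = 1 -> N (x' - y') = 1 ->
  N (x - x') <= 1 -> N (x - y') <= 1 -> N (y - x') <= 1 -> N (y - y') <= 1 ->
  y + s *: (x - y) = y' + ta *: (x' - y') -> s < 0 ->
  same_face (x - y) (x' - y') \/ same_face (x - y) (y' - x').
Proof.
move=> v1 v1' xx xy yx yy e s0.
have ey : y = y' + ta *: (x' - y') - s *: (x - y) by rewrite -e addrK.
have ex : x = y' + ta *: (x' - y') + (1 - s) *: (x - y).
  by rewrite -{1}(subrK y x) {2}ey; vec; ring.
have [t0|t0] := ltP ta 0.
  left; apply: (@cross_aux _ _ (- s) (- ta)); rewrite ?oppr_gt0//.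
    suff -> : (1 - s) *: (x - y) - - ta *: (x' - y') = x - y' by [].
    by rewrite {2}ex; vec; ring.
  suff -> : (1 - ta) *: (x' - y') - - s *: (x - y) = x' - y by rewrite nrmC.
  by rewrite {2}ey; vec; ring.
have [t1|t1] := ltP 1 ta.
  right; apply: (@cross_aux _ _ (- s) (ta - 1)); rewrite ?oppr_gt0 ?subr_gt0//.
  - by rewrite nrmC.
  - suff -> : (1 - s) *: (x - y) - (ta - 1) *: (y' - x') = x - x' by [].
    by rewrite {2}ex; vec; ring.
  - suff -> : (1 + (ta - 1)) *: (y' - x') - - s *: (x - y) = y' - y by rewrite nrmC.
    by rewrite {2}ey; vec; ring.
exfalso; have e' : (1 - s) *: (x - y) = (1 - ta) *: (x - y') + ta *: (x - x').
  have -> : (1 - s) *: (x - y) = x - (y' + ta *: (x' - y')) by rewrite -e; vec; ring.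
  by vec; ring.
have : N ((1 - s) *: (x - y)) <= (1 - ta) + ta by rewrite e'; apply: nrm_lin1 => //; lra.
by rewrite nrmZp// ?v1; lra.
Qed.

(** Unless the chords are parallel, their lines meet; a meeting point outside either chord is
    handled by [cross_out] after exchanging ends or chords. *)
Lemma crossing x y x' y' : N (x - y) = 1 -> N (x' - y') = 1 ->
  N (x - x') <= 1 -> N (x - y') <= 1 -> N (y - x') <= 1 -> N (y - y') <= 1 ->
  [\/ same_face (x - y) (x' - y'), same_face (x - y) (y' - x') |
    exists s ta, [/\ 0 <= s, s <= 1, 0 <= ta, ta <= 1 &
                     y + s *: (x - y) = y' + ta *: (x' - y')]].
Proof.
move=> v1 v1' xx xy yx yy.
have sg1 : (1 : R) != 0 by exact: oner_neq0.
have [c0|c0] := eqVneq (cr 1 (x - y) (x' - y')) 0.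
  have [e|e] := cr_unit0 normN sg1 v1 v1' c0.
    by apply: Or31; rewrite e; exact: same_face_refl.
  by apply: Or32; rewrite -(opprB x' y') e opprK; exact: same_face_refl.
have := cr_decomp (y' - y) c0; set s := (_ / _); set ta := (_ / _) => e.
have e1 : y + s *: (x - y) = y' + (- ta) *: (x' - y').
  have -> : s *: (x - y) = (y' - y) - ta *: (x' - y') by rewrite e addrK.
  by vec; ring.
move: (- ta) e1 => {e} {}ta e.
have [s0|s0] := ltP s 0.
  by case: (cross_out v1 v1' xx xy yx yy e s0); [apply: Or31 | apply: Or32].
have [s1|s1] := ltP 1 s.
  have e' : x + (1 - s) *: (y - x) = y' + ta *: (x' - y') by rewrite -e; vec; ring.
  have s1' : 1 - s < 0 by lra.
  rewrite nrmC// in v1; case: (cross_out v1 v1' yx yy xx xy e' s1').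
    by move=> h; apply: Or32; exact: same_faceB.
  by move=> h; apply: Or31; exact: same_faceB.
have xx' := xx; have xy' := xy; have yx' := yx; have yy' := yy.
rewrite nrmC// in xx'; rewrite nrmC// in xy'; rewrite nrmC// in yx'; rewrite nrmC// in yy'.
have [t0|t0] := ltP ta 0.
  case: (cross_out v1' v1 xx' yx' xy' yy' (esym e) t0); first by move=> /same_faceC; apply: Or31.
  by move=> h; apply: Or32; exact/same_faceC/same_faceB.
have [t1|t1] := ltP 1 ta; last by apply: Or33; exists s, ta.
have e' : x' + (1 - ta) *: (y' - x') = y + s *: (x - y) by rewrite e; vec; ring.
have t1' : 1 - ta < 0 by lra.
have v2' := v1'; rewrite nrmC// in v2'.
case: (cross_out v2' v1 xy' yy' xx' yx' e' t1'); first by move=> /same_faceC; apply: Or32.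
by move=> h; apply: Or31; exact/same_faceC/same_faceB.
Qed.

Hypothesis nangled : ~ angled N.

Lemma unit_circleP p : N p = 1 -> unit_circle N p.
Proof.
move=> p1; split.
  by apply: subset_closure; rewrite /unit_disk /closed_ball_ /= sub0r nrmN// p1.
rewrite /interior/= => /nbhs_ballP[e /= e0]; rewrite -ball_normE => sub.
(* Small enough that [(1 + d) *: p], which lies outside the disk, is still in the ball of radius
   [e]. *)
pose d := e / (2 * (`|p| + 1)).
have p0 : 0 <= `|p| by exact: normr_ge0.
have d0 : 0 < d by rewrite divr_gt0//; lra.
have := sub ((1 + d) *: p); rewrite /unit_disk /closed_ball_ /=.
rewrite sub0r nrmN// nrmZp// ?p1; last lra.
have -> : p - (1 + d) *: p = (- d) *: p by vec; ring.
rewrite normrZ normrN gtr0_norm//.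
have dp : d * (2 * (`|p| + 1)) = e by rewrite divfK//; lra.
have h : d * `|p| < e by nra.
by move=> /(_ h); lra.
Qed.

(** Otherwise two noncollinear segments of the unit circle meet at [v]. This is where the norm not
    being angled enters. *)
Lemma same_face_collinear u v w : N u = 1 -> N v = 1 -> N w = 1 -> same_face u v -> same_face v w ->
  cr 1 (v - u) (w - v) = 0.
Proof.
move=> u1 v1 w1 uv vw; apply: contrapT => c; apply: nangled; exists u, v, w; split.
  move=> [p [d [_ [l eu] [l' ev] [l'' ew]]]]; apply: c; rewrite eu ev ew.
  by rewrite /cr !mxE; ring.
have seg a b : N a = 1 -> N b = 1 -> same_face a b -> segment a b `<=` unit_circle N.
  move=> a1 b1 ab x [l]; rewrite /= in_itv/= => /andP[l0 l1] <-.
  apply: unit_circleP; apply/eqP; rewrite eq_le; apply/andP; split.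
    apply: le_trans (_ : (1 - l) + l <= _); last lra.
    by apply: nrm_lin1 => //; rewrite ?a1 ?b1//; lra.
  have -> : (1 - l) *: a + l *: b = a + l *: (b - a) by vec; ring.
  exact: face_line.
by move=> x [|]; exact: seg.
Qed.

Lemma same_face_line a b w : N a = 1 -> N b = 1 -> N w = 1 -> a != b ->
  same_face a b -> same_face a w ->
  exists ta, w = a + ta *: (b - a).
Proof.
move=> a1 b1 w1 ab sab saw; have := same_face_collinear b1 a1 w1 (same_faceC sab) saw.
have ba : a - b != 0 by rewrite subr_eq0.
move=> /(cr_parallel (oner_neq0 _) ba)[k e]; exists (- k).
by rewrite -[w in LHS](subrK a) e; vec; ring.
Qed.

Lemma same_face_trans u v w : N u = 1 -> N v = 1 -> N w = 1 ->
  same_face u v -> same_face v w -> same_face u w.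
Proof.
move=> u1 v1 w1 uv vw; have [->//|uv0] := eqVneq u v.
have [ta e] : exists ta, w = u + ta *: (v - u).
  have vu : v != u by rewrite eq_sym.
  have [k ->] := same_face_line v1 u1 w1 vu (same_faceC uv) vw.
  by exists (1 - k); vec; ring.
by rewrite e; apply: (same_face_on u1 v1 uv _).2; rewrite -e w1.
Qed.

(** The chords and the two diagonals have the same sum, of norm 2, so the diagonals are unit
    vectors; all four vectors share a face with the midpoint [c]. *)
Lemma rect x y x' y' : N (x - y) = 1 -> N (x' - y') = 1 -> same_face (x - y) (x' - y') ->
  N (x - y') <= 1 -> N (x' - y) <= 1 ->
  [/\ N (x - y') = 1, N (x' - y) = 1, same_face (x - y) (x - y') & same_face (x - y) (x' - y)].
Proof.
move=> v1 v1' s h1 h2.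
have e : (x - y) + (x' - y') = (x - y') + (x' - y) by vec; ring.
have s' := s; rewrite /same_face e in s'.
have t := nrmD normN (x - y') (x' - y).
have u1 : N (x - y') = 1 by lra.
have u2 : N (x' - y) = 1 by lra.
pose c := 2^-1 *: ((x - y) + (x' - y')).
have c1 : N c = 1 by rewrite nrmZp// ?s; lra.
have half a b : N a = 1 -> N b = 1 -> same_face a b -> c = 2^-1 *: (a + b) -> same_face a c.
  move=> a1 b1 ab ec; have ec' : c = a + 2^-1 *: (b - a) by rewrite ec; vec; field.
  by rewrite ec'; apply: (same_face_on a1 b1 ab _).2; rewrite -ec' c1.
have sc := half _ _ v1 v1' s erefl.
have sc1 : same_face (x - y') c by apply: (half _ _ u1 u2 s'); rewrite /c e.
have sc2 : same_face (x' - y) c by apply: (half _ _ u2 u1 (same_faceC s')); rewrite /c e addrC.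
by split=> //; [exact: same_face_trans v1 c1 u1 sc (same_faceC sc1) |
                exact: same_face_trans v1 c1 u2 sc (same_faceC sc2)].
Qed.

(** Compare the chord from [ga] to [xi] with the spokes from 0 to [a] and to [b]. A spoke that it
    does not cross gives a flat alternative; if it crosses both, it passes through 0, and then
    [ga = 0]. *)
Lemma spoke a b xi ga al be : N a = 1 -> N b = 1 -> cr 1 a b != 0 ->
  N (a - b) <= 1 -> N xi <= 1 -> N (xi - a) <= 1 -> N (xi - b) <= 1 ->
  N ga <= 1 -> N (ga - a) <= 1 -> N (ga - b) <= 1 -> N (xi - ga) = 1 ->
  0 < al -> 0 < be -> xi = al *: a + be *: b ->
  [\/ ga = 0, [/\ N xi = 1, same_face a xi & N (a - ga) = 1] |
    [/\ N xi = 1, same_face b xi & N (b - ga) = 1]].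
Proof.
move=> a1 b1 cab ab xi1 xia xib ga1 gaa gab xg al0 be0 exi.
have ba : N (b - a) <= 1 by rewrite nrmC.
have al1 : al <= 1 by apply: le_trans xi1; rewrite exi; apply: coef_le => //; exact: ltW.
have be1 : be <= 1 by apply: le_trans xi1; rewrite exi addrC; apply: coef_le => //; exact: ltW.
have key c d k l : N c = 1 -> N d = 1 -> N (c - d) <= 1 -> 0 < k -> k <= 1 -> 0 < l -> l <= 1 ->
    xi = k *: c + l *: d -> N (xi - c) <= 1 -> N (ga - c) <= 1 ->
    [\/ [/\ N xi = 1, same_face c xi & N (c - ga) = 1] |
      exists s ta, [/\ 0 <= s, s <= 1, 0 <= ta, ta <= 1 & ga + s *: (xi - ga) = ta *: c]].
  move=> c1 d1 cd k0 k1 l0 l1 e xc gc.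
  have c10 : N (c - 0) = 1 by rewrite subr0.
  have x0 : N (xi - 0) <= 1 by rewrite subr0.
  have g0 : N (ga - 0) <= 1 by rewrite subr0.
  have cg : N (c - ga) <= 1 by rewrite nrmC.
  case: (crossing xg c10 xc x0 gc g0).
  - move=> s; have [h1 h2 s1 s2] := rect xg c10 s x0 cg.
    move: h1 s s1; rewrite !subr0 => h1 s s1; left; split=> //.
    exact: same_face_trans c1 xg h1 (same_faceC s) s1.
  - move=> s; have c0 : N (0 - c) = 1 by rewrite nrmC.
    have h0 : N (0 - ga) <= 1 by rewrite nrmC.
    have [h1 h2 s1 s2] := rect xg c0 s xc h0.
    have := same_face_trans c0 xg h1 (same_faceC s) s1; rewrite /same_face => h.
    (* Sharing a face would give this sum norm 2, but its expansion has norm at most [2 - k]. *)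
    have : N (0 - c + (xi - c)) <= (2 - k - l) + l.
      have -> : 0 - c + (xi - c) = (2 - k - l) *: (- c) + l *: (d - c).
        by rewrite e; vec; ring.
      by apply: nrm_lin1 => //; rewrite ?nrmN// 1?nrmC//; lra.
    by rewrite h; lra.
  - move=> [s [ta [s0 s1 t0 t1]]]; rewrite subr0 add0r => es.
    by right; exists s, ta.
have exi' : xi = be *: b + al *: a by rewrite addrC.
case: (key a b al be) => // [|[s [ta [s0 s1 t0 t1 es]]]]; first by move=> h; apply: Or32.
case: (key b a be al) => // [|[s' [ta' [s0' s1' t0' t1' es']]]]; first by move=> h; apply: Or33.
apply: Or31.
have exg : ga = xi - (xi - ga) by vec; ring.
(* [Y] and [X] are the coordinates of the chord direction [G]. Comparing them at the two crossing
   points shows that these points coincide, hence are both 0. *)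
pose G := xi - ga; pose X := cr 1 a G / cr 1 a b; pose Y := cr 1 G b / cr 1 a b.
have eS : (1 - s) *: G = (al - ta) *: a + be *: b.
  have -> : (1 - s) *: G = xi - (ga + s *: (xi - ga)) by rewrite /G; vec; ring.
  by rewrite es exi; vec; ring.
have eS' : (1 - s') *: G = al *: a + (be - ta') *: b.
  have -> : (1 - s') *: G = xi - (ga + s' *: (xi - ga)) by rewrite /G; vec; ring.
  by rewrite es' exi; vec; ring.
have q1 : (1 - s) * X = be.
  by rewrite /X mulrA -crZr eS !crE mulr0 add0r mulfK.
have q2 : (1 - s') * X = be - ta'.
  by rewrite /X mulrA -crZr eS' !crE mulr0 add0r mulfK.
have q3 : (1 - s) * Y = al - ta.
  by rewrite /Y mulrA -crZl eS !crE mulr0 addr0 mulfK.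
have q4 : (1 - s') * Y = al.
  by rewrite /Y mulrA -crZl eS' !crE mulr0 addr0 mulfK.
have S0 : 0 < 1 - s.
  by rewrite lt_def subr_ge0 s1 andbT; apply: contra_eq_neq q1 => ->; rewrite mul0r lt_eqF.
have S0' : 0 < 1 - s'.
  by rewrite lt_def subr_ge0 s1' andbT; apply: contra_eq_neq q4 => ->; rewrite mul0r lt_eqF.
have X0 : 0 < X by rewrite -(pmulr_rgt0 _ S0) q1.
have Y0 : 0 < Y by rewrite -(pmulr_rgt0 _ S0') q4.
have le1 : 1 - s' <= 1 - s by rewrite -(ler_pM2r X0) q1 q2; lra.
have le2 : 1 - s <= 1 - s' by rewrite -(ler_pM2r Y0) q3 q4; lra.
have ess : s' = s by lra.
have ta00 : ta = 0 by rewrite ess in q4; lra.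
pose c := s / (1 - s).
have c0 : 0 <= c by rewrite divr_ge0// ltW.
have eg : ga = - (c *: xi).
  have : (1 - s) *: ga = - (s *: xi).
    have := es; rewrite ta00 scale0r => /eqP; rewrite addr_eq0 => /eqP eg.
    have -> : (1 - s) *: ga = ga - s *: ga by vec; ring.
    by rewrite {1}eg; vec; ring.
  move=> /(congr1 (fun z => (1 - s)^-1 *: z)); rewrite scalerA mulVf ?gt_eqF// scale1r => ->.
  by rewrite /c; vec; ring.
(* Now [ga] is the multiple [- c] of [xi], and a positive [c] would put it farther than 1 from
   [a]. *)
have : 1 + c * al <= 1.
  apply: le_trans gaa; rewrite nrmC//.
  have -> : a - ga = (1 + c * al) *: a + (c * be) *: b by rewrite eg exi; vec; ring.
  by apply: coef_le => //; rewrite mulr_ge0// ltW.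
move=> h; have c00 : c = 0 by nra.
by rewrite eg c00 scale0r oppr0.
Qed.

End Face.

(** * Comparison of [N] with the standard norm *)

Section Topology.
Variables (R : realType) (N : 'rV[R]_2 -> R).
Hypothesis normN : is_norm N.
Implicit Types (x y z u v w a b : 'rV[R]_2) (sg : R).

Lemma entry_le x j : `|x ord0 j| <= `|x|.
Proof.
rewrite [leRHS]/Num.Def.normr /= mx_normrE; apply/bigmax_geP; right => /=.
by exists (ord0, j).
Qed.

Lemma nrm_le_mx : exists2 M, 0 < M & forall x, N x <= M * `|x|.
Proof.
pose e0 := delta_mx ord0 ord0 : 'rV[R]_2; pose e1 := delta_mx ord0 ord_max : 'rV[R]_2.
have E0 := nrm_ge0 normN e0; have E1 := nrm_ge0 normN e1.
exists (N e0 + N e1 + 1) => [|x]; first lra.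
have -> : N x = N (x ord0 ord0 *: e0 + x ord0 ord_max *: e1).
  by congr N; apply: row2P; rewrite !mxE /=; ring.
apply: le_trans (nrmD normN _ _) _; rewrite !nrmZ//.
have h0 := entry_le x ord0; have h1 := entry_le x ord_max.
have : 0 <= `|x| by []. nra.
Qed.

Lemma lipschitz_continuous (f : 'rV[R]_2 -> R) M : 0 < M ->
  (forall x y, `|f x - f y| <= M * N (x - y)) -> continuous f.
Proof.
move=> M0 fM; have [K K0 NK] := nrm_le_mx.
move=> x; apply/(@cvgrPdist_le _ _ _ (nbhs x) (nbhs_filter x)) => e e0.
apply/nbhs_ballP; exists ((M * K)^-1 * e) => /=.
  by rewrite mulr_gt0// invr_gt0 mulr_gt0.
move=> y; rewrite -ball_normE /ball_ /= => /ltW.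
rewrite ler_pdivlMl ?mulr_gt0//; apply: le_trans; apply: le_trans (fM _ _) _.
by rewrite -mulrA ler_pM2l.
Qed.

Lemma nrm_continuous : continuous N.
Proof.
apply: (@lipschitz_continuous _ 1) => // x y; rewrite mul1r ler_norml.
have := nrmB normN x y; have := nrmB normN y x; have := nrmC normN x y; lra.
Qed.

(** [N] attains a positive minimum on the compact unit sphere of the standard norm. *)
Lemma mx_le_nrm : exists2 K, 0 < K & forall x, `|x| <= K * N x.
Proof.
pose S : set 'rV[R]_2 := [set x | `|x| = 1].
have clS : closed S.
  have -> : S = (fun x : 'rV[R]_2 => `|x|) @^-1` [set 1] by [].
  apply: preimage_closed; last exact: closed_eq.
  by move=> x _; exact: norm_continuous.
have cS : compact S.
  apply: bounded_closed_compact => //; exists 1; split => // e e1 x /=.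
  by rewrite /S /= => ->; exact: ltW.
have S0 : S !=set0.
  have n0 : const_mx 1 != 0 :> 'rV[R]_2.
    by apply/eqP => /rowP/(_ ord0); rewrite !mxE => /eqP; rewrite oner_eq0.
  exists (`|const_mx 1 : 'rV[R]_2|^-1 *: const_mx 1).
  by rewrite /S /= normrZ normfV normr_id mulVf// normr_eq0.
have [c cS' cmin] := EVT_min_rV S0 cS (continuous_subspaceT nrm_continuous).
have c1 : `|c| = 1 by move: cS'; rewrite inE.
have c0 : 0 < N c.
  by apply: nrm_gt0 => //; apply/eqP => c0; move: c1; rewrite c0 normr0; lra.
exists (N c)^-1 => [|x]; first by rewrite invr_gt0.
rewrite -(ler_pM2l c0) mulrA mulfV ?gt_eqF// mul1r.
have [->|x0] := eqVneq x 0; first by rewrite normr0 mulr0 nrm_ge0.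
have nx : 0 < `|x| by rewrite normr_gt0.
have := cmin (`|x|^-1 *: x); rewrite inE /S /= normrZ normfV normr_id mulVf ?normr_eq0//.
have i0 : 0 <= `|x|^-1 by rewrite invr_ge0.
move=> /(_ erefl); rewrite nrmZp//.
by rewrite ler_pdivlMl// mulrC.
Qed.

Lemma cr_le_nrm sg a : exists2 K, 0 < K & forall x, `|cr sg a x| <= K * N x.
Proof.
have [K K0 NK] := mx_le_nrm.
have s0 : 0 <= `|sg| by []. have a0 : 0 <= `|a| by [].
exists (2 * `|sg| * `|a| * K + 1) => [|x].
  have : 0 <= `|sg| * `|a| * K by rewrite !mulr_ge0// ltW.
  lra.
rewrite /cr normrM.
have h0 := entry_le a ord0; have h1 := entry_le a ord_max.
have g0 := entry_le x ord0; have g1 := entry_le x ord_max.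
have : `|a ord0 ord0 * x ord0 ord_max - a ord0 ord_max * x ord0 ord0| <= 2 * (`|a| * `|x|).
  apply: le_trans (ler_normB _ _) _; rewrite !normrM mulr2n mulrDl mul1r.
  by apply: lerD; apply: ler_pM.
move=> h; apply: (@le_trans _ _ (`|sg| * (2 * (`|a| * `|x|)))); first exact: ler_wpM2l.
apply: (@le_trans _ _ (`|sg| * (2 * (`|a| * (K * N x))))); last first.
  have := nrm_ge0 normN x; lra.
by rewrite !ler_wpM2l.
Qed.

End Topology.

(** * Uniform positive lower bounds *)

Lemma fin_gap (R : realType) n (f : 'I_n -> R) :
  exists2 e, 0 < e & forall l, 0 < f l -> e <= f l.
Proof.
(* The default value 1 serves when no value is positive. *)
exists (\big[Num.min/1]_(l | 0 < f l) f l); first exact/bigmin_gtP.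
by move=> l fl; exact: bigmin_le_cond.
Qed.


Lemma pos_lower_bound (T : topologicalType) (R : realType) (f : T -> R) (A : set T) :
  compact A -> continuous f -> (forall x, A x -> 0 < f x) ->
  exists2 e, 0 < e & forall x, A x -> e <= f x.
Proof.
move=> cA cf f0; have [->|A0] := eqVneq A set0; first by exists 1 => // x [].
have /set0P/compact_EVT_min := A0.
move=> /(_ _ _ cA (continuous_subspaceT cf))[c Ac cmin].
exists (f c); first by apply: f0; rewrite inE in Ac.
by move=> x Ax; apply: cmin; rewrite inE.
Qed.

(** * From diametral endpoints to all of [C] by compactness *)

Section Thicken.
Variables (R : realType) (N : 'rV[R]_2 -> R).
Hypothesis normN : is_norm N.
Variable C : set 'rV[R]_2.
Hypothesis Cd : forall x y, C x -> C y -> N (x - y) <= 1.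
Hypothesis cC : compact C.

Lemma gap_continuous : continuous (fun z : 'rV[R]_2 * 'rV[R]_2 => 1 - N (z.1 - z.2)).
Proof.
move=> z; apply: cvgB; first exact: cvg_cst.
apply: (@continuous_comp _ _ _ (fun z : 'rV[R]_2 * 'rV[R]_2 => z.1 - z.2) N).
  by apply: cvgB; [exact: cvg_fst | exact: cvg_snd].
exact: nrm_continuous.
Qed.

Lemma cr_continuous sg (a c : 'rV[R]_2) : continuous (fun x : 'rV[R]_2 => cr sg a (x - c)).
Proof.
have [K K0 hK] := cr_le_nrm normN sg a.
apply: (lipschitz_continuous normN K0) => x y; rewrite -crBr.
by have -> : x - c - (y - c) = x - y by vec; ring.
Qed.

(* Relaxing [h p <= 0] to [h p < e] covers also the points of [C] near the endpoints of
   diametral chords; the other points of [C] can be put in every covering set. *)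
Lemma thicken n k (h : 'I_n -> 'rV[R]_2 -> R) : (k <= n)%N ->
  (forall p, continuous (h p)) ->
  (forall p x x', C x -> C x' -> h p x <= 0 -> h p x' <= 0 -> N (x - x') < 1) ->
  (forall x y, C x -> C y -> N (x - y) = 1 -> (k <= #|[pred p | (h p x <= 0)%R]|)%N) ->
  exists2 F : 'I_n -> set 'rV[R]_2,
    forall p, F p `<=` C /\
      exists2 e, 0 < e & forall x x', F p x -> F p x' -> N (x - x') <= 1 - e &
    forall x, C x -> (k <= #|[pred p | x \in F p]|)%N.
Proof.
move=> kn hc hsep hcov.
have fstc (f : 'rV[R]_2 -> R) : continuous f ->
    continuous (fun z : 'rV[R]_2 * 'rV[R]_2 => f z.1).
  by move=> fc z; apply: (@continuous_comp _ _ _ fst f); [exact: cvg_fst | exact: fc].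
have sndc (f : 'rV[R]_2 -> R) : continuous f ->
    continuous (fun z : 'rV[R]_2 * 'rV[R]_2 => f z.2).
  by move=> fc z; apply: (@continuous_comp _ _ _ snd f); [exact: cvg_snd | exact: fc].
have sep p : exists2 e, 0 < e & forall x x', C x -> C x' ->
    h p x < e -> h p x' < e -> N (x - x') <= 1 - e.
  (* Positive on [C * C]: where both values of [h p] are nonpositive, the distance is less than 1. A
     positive lower bound of [f] is the margin [e]. *)
  pose f (z : 'rV[R]_2 * 'rV[R]_2) := Num.max (Num.max (h p z.1) (h p z.2)) (1 - N (z.1 - z.2)).
  have fc : continuous f.
    apply: max_fun_continuous gap_continuous.
    by apply: max_fun_continuous; [exact: fstc | exact: sndc].
  have [|e e0 he] := pos_lower_bound (compact_setX cC cC) fc.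
    move=> [x x'] [/= Cx Cx']; rewrite /f /= !lt_max.
    have [//|h1] := ltP 0 (h p x); have [|h2] := ltP 0 (h p x'); first by rewrite orbT.
    by rewrite subr_gt0 (hsep p).
  exists e => // x x' Cx Cx' h1 h2; have := he (x, x') (conj Cx Cx').
  by rewrite /f /= !le_max leNgt h1 leNgt h2 /= => ?; lra.
have [e e0 he] : exists2 e, 0 < e & forall p x x', C x -> C x' ->
    h p x < e -> h p x' < e -> N (x - x') <= 1 - e.
  pose g p := projT1 (cid2 (sep p)).
  have [e e0 ge] := fin_gap g; exists e => // p x x' Cx Cx' h1 h2.
  have := ge p; rewrite /g; case: (cid2 _) => e' e0' H /= /(_ e0') le.
  apply: le_trans (H _ _ Cx Cx' (lt_le_trans h1 le) (lt_le_trans h2 le)) _; lra.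
(* The points covered often enough by the relaxed pieces form an open set containing every diametral
   endpoint, so the rest of [C] is compact and uniformly closer than 1 to all of [C]. *)
pose U : set 'rV[R]_2 := [set x | (k <= #|[pred p | (h p x < e)%R]|)%N].
have oU : open U.
  rewrite openE => x Ux; rewrite /interior /=.
  have : \forall x' \near nbhs x, forall p, h p x < e -> h p x' < e.
    apply: filter_forall => p; have [lt|le] := ltP (h p x) e; last by apply: filterE.
    have : \forall x' \near nbhs x, h p x' < e.
      exact: (cvgr_lt (h p x)) (hc p x) _ lt.
    by apply: filterS => x' hx' _.
  apply: filterS => x' hx'; rewrite /U /=; apply: leq_trans Ux _.
  by apply: subset_leq_card; apply/fintype.subsetP => p; rewrite !inE; exact: hx'.
have cW : compact (C `&` ~` U).
  by apply: compact_closedI => //; exact: open_closedC.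
have [d d0 hd] : exists2 d, 0 < d &
    forall z : 'rV[R]_2 * 'rV[R]_2, ((C `&` ~` U) `*` C) z -> d <= 1 - N (z.1 - z.2).
  apply: pos_lower_bound (compact_setX cW cC) gap_continuous _.
  move=> [x y] [/= [Cx nU] Cy]; rewrite subr_gt0 lt_neqAle Cd// andbT.
  apply/eqP => xy; apply: nU; apply: leq_trans (hcov x y Cx Cy xy) _.
  by apply: subset_leq_card; apply/fintype.subsetP => p; rewrite !inE => /le_lt_trans; exact.
pose F p : set 'rV[R]_2 := [set x | C x /\ (h p x < e \/ ~ U x)].
exists F.
  move=> p; split=> [x [] //|]; exists (Num.min e d); first by rewrite lt_min e0.
  have mine : Num.min e d <= e by rewrite ge_min lexx.
  have mind : Num.min e d <= d by rewrite ge_min lexx orbT.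
  have far x x' : C x -> C x' -> ~ U x -> N (x - x') <= 1 - Num.min e d.
    by move=> Cx Cx' nU; have := hd (x, x') (conj (conj Cx nU) Cx') => /=; lra.
  move=> x x' [Cx [hx|nU]] [Cx' [hx'|nU']].
  - by apply: le_trans (he _ _ _ Cx Cx' hx hx') _; lra.
  - by rewrite nrmC//; exact: far.
  - exact: far.
  - exact: far.
move=> x Cx; have [Ux|nU] := pselect (U x).
  apply: leq_trans Ux _; apply: subset_leq_card; apply/fintype.subsetP => p.
  by rewrite !inE => hp; split=> //; left.
have -> : #|[pred p | x \in F p]| = n.
  rewrite -[RHS]card_ord; apply: eq_card => p; rewrite !inE.
  by apply/mem_set; split=> //; right.
exact: kn.
Qed.

End Thicken.

(** * Arcs and diametral partners in an intersection of unit disks *)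

Section Body.
Variables (R : realType) (N : 'rV[R]_2 -> R).
Hypothesis normN : is_norm N.
Hypothesis nangled : ~ angled N.
Variables (C : set 'rV[R]_2) (m : nat) (t : 'I_m -> 'rV[R]_2).
Hypothesis Cd : forall x y, C x -> C y -> N (x - y) <= 1.
Hypothesis Cm : forall z, (forall i, N (z - t i) <= 1) -> C z.
Hypothesis Ct : forall i, C (t i).
Implicit Types (x y z u v w a b q : 'rV[R]_2) (sg : R) (i j l : 'I_m).
Local Notation same_face := (same_face N).

(** Otherwise [x] could be pushed a little away from [y] inside every disk, giving a distance
    greater than 1 in [C]. *)
Lemma diametral_center x y : C x -> C y -> N (x - y) = 1 -> exists l, N (x - t l) = 1.
Proof.
move=> Cx Cy xy; apply: contrapT => /forallNP h.
have lt1 l : N (x - t l) < 1 by rewrite lt_neqAle Cd// andbT; apply/eqP.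
have [e e0 eh] := fin_gap (fun l => 1 - N (x - t l)).
have := Cd (_ : C (x + e *: (x - y))) Cy.
have -> : x + e *: (x - y) - y = (1 + e) *: (x - y) by vec; ring.
rewrite nrmZp// ?xy; last lra.
move=> H; have : (1 + e) * 1 <= 1.
  apply: H; apply: Cm => l.
  have -> : x + e *: (x - y) - t l = (x - t l) + e *: (x - y) by vec; ring.
  apply: le_trans (nrmD normN _ _) _; rewrite (nrmZp normN _ (ltW e0)) xy.
  have := eh l; rewrite subr_gt0 => /(_ (lt1 l)); lra.
lra.
Qed.

Lemma line_ext x e : C x -> e != 0 ->
  exists ta, [/\ 0 <= ta, C (x + ta *: e) & forall ta', C (x + ta' *: e) -> ta' <= ta].
Proof.
move=> Cx e0; have Ne := nrm_gt0 normN e0.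
pose S := [set ta | C (x + ta *: e)].
have S0 : S 0 by rewrite /S /= scale0r addr0.
have ub : has_ubound S.
  exists (N e)^-1 => ta /= Sta; have := Cd Sta Cx.
  rewrite addrAC subrr add0r nrmZ// -ler_pdivlMr// mul1r.
  by apply: le_trans; exact: ler_norm.
have hs : has_sup S by split => //; exists 0.
have le_s ta : S ta -> ta <= sup S by move=> h; exact: ub_le_sup.
exists (sup S); split => //; first exact: le_s.
(* The supremum is attained because the disk constraints are closed. *)
apply: Cm => i; apply/ler_addgt0Pr => d d0.
have [ta Sta lta] := sup_adherent (divr_gt0 d0 Ne) hs.
have -> : x + sup S *: e - t i = (x + ta *: e - t i) + (sup S - ta) *: e by vec; ring.
apply: le_trans (nrmD normN _ _) _; apply: lerD; first exact: Cd.
rewrite nrmZp// ?subr_ge0 ?le_s// -ler_pdivlMr//; lra.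
Qed.

Lemma fanC sg q a b w al be : cr sg a b != 0 -> C q -> C (q + a) -> C (q + b) ->
  N a = 1 -> N b = 1 -> N w = 1 -> 0 < al -> 0 < be -> w = al *: a + be *: b ->
  C (q + w).
Proof.
move=> cab Cq Ca Cb a1 b1 w1 al0 be0 ew; apply: Cm => i.
have -> : q + w - t i = (q - t i) + w by vec; ring.
apply: fan cab a1 b1 w1 _ _ _ _ al0 be0 ew => //.
- by have := Cd Ca Cb; rewrite opprD addrACA subrr add0r.
- exact: Cd.
- by rewrite addrAC; exact: Cd.
- by rewrite addrAC; exact: Cd.
Qed.

Lemma spokeC o a b x g al be : C o -> C (o + a) -> C (o + b) -> C x -> C g ->
  N a = 1 -> N b = 1 -> cr 1 a b != 0 -> N (x - g) = 1 ->
  0 < al -> 0 < be -> x = o + (al *: a + be *: b) ->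
  [\/ g = o, [/\ N (x - o) = 1, same_face a (x - o) & N (o + a - g) = 1] |
    [/\ N (x - o) = 1, same_face b (x - o) & N (o + b - g) = 1]].
Proof.
move=> Co Ca Cb Cx Cg a1 b1 cab xg al0 be0 ex.
have exi : x - o = al *: a + be *: b by rewrite ex; vec; ring.
have d1 : N (a - b) <= 1 by have := Cd Ca Cb; rewrite opprD addrACA subrr add0r.
have d2 c : C (o + c) -> N (x - o - c) <= 1.
  by move=> Cc; rewrite -addrA -opprD; exact: Cd.
have d3 c : C (o + c) -> N (g - o - c) <= 1.
  by move=> Cc; rewrite -addrA -opprD; exact: Cd.
have xg' : N (x - o - (g - o)) = 1 by rewrite opprB addrA subrK.
have := spoke normN nangled a1 b1 cab d1 (Cd Cx Co) (d2 _ Ca) (d2 _ Cb) (Cd Cg Co)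
  (d3 _ Ca) (d3 _ Cb) xg' al0 be0 exi.
have r c : c - (g - o) = o + c - g by vec; ring.
rewrite !r => -[/eqP|h|h]; last 2 first.
- exact: Or32.
- exact: Or33.
by rewrite subr_eq0 => /eqP; exact: Or31.
Qed.

Lemma rectC x y x' y' : C x -> C y -> C x' -> C y' ->
  N (x - y) = 1 -> N (x' - y') = 1 -> same_face (x - y) (x' - y') ->
  [/\ N (x - y') = 1, N (x' - y) = 1, same_face (x - y) (x - y') & same_face (x - y) (x' - y)].
Proof. by move=> Cx Cy Cx' Cy' h1 h2 h; apply: rect => //; exact: Cd. Qed.

Lemma crossC x y x' y' : C x -> C y -> C x' -> C y' ->
  N (x - y) = 1 -> N (x' - y') = 1 ->
  [\/ same_face (x - y) (x' - y'), same_face (x - y) (y' - x') |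
    exists s ta, [/\ 0 <= s, s <= 1, 0 <= ta, ta <= 1 &
                     y + s *: (x - y) = y' + ta *: (x' - y')]].
Proof. by move=> Cx Cy Cx' Cy' h1 h2; apply: crossing => //; exact: Cd. Qed.

Definition off_centers q := forall l, q <> t l.

(** For [b] near [a], the point [q + b] is at distance 1 from some center, which is not [q]. By
    [spokeC], [b] shares a face with [a] or with a fixed [b0]; if never with [a], letting [b] tend
    to [a] puts [a] and [b0] in one face. *)
Lemma apex_limit sg q a : sg != 0 -> C q -> off_centers q -> N a = 1 -> C (q + a) ->
  (forall e, 0 < e -> exists b, [/\ N b = 1, C (q + b), 0 < cr sg a b & N (b - a) < e]) ->
  exists b, [/\ N b = 1, C (q + b), 0 < cr sg a b & same_face a b].
Proof.
move=> sg0 Cq qT a1 Ca H; apply: contrapT => /forallNP noflat.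
have [b0 [b01 Cb0 cab0 _]] := H 1 ltr01.
apply: (noflat b0); split=> //.
have [K K0 hK] := cr_le_nrm normN sg b0.
have tri : N (a + b0) <= 2 by have := nrmD normN a b0; lra.
apply/eqP; rewrite eq_le tri /=; apply/ler_addgt0Pr => e e0.
pose d := Num.min e (cr sg a b0 / K).
have d0 : 0 < d by rewrite lt_min e0 divr_gt0.
have [b [b1 Cb cab bd]] := H d d0.
have be : N (b - a) < e by apply: lt_le_trans bd _; rewrite ge_min lexx.
have cbb0 : 0 < cr sg b b0.
  have : N (b - a) < cr sg a b0 / K by apply: lt_le_trans bd _; rewrite ge_min lexx orbT.
  rewrite ltr_pdivlMr// => h; have := hK (b - a); rewrite ler_norml crBr => /andP[_].
  rewrite (crC _ a b0) (crC _ b b0); lra.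
have xq : N (q + b - q) = 1 by rewrite addrAC subrr add0r.
have [l xl] := diametral_center Cb Cq xq.
have eb := cr_decomp b (lt0r_neq0 cab0).
have cab1 : cr 1 a b0 != 0.
  by apply: contra_neq (lt0r_neq0 cab0); rewrite /cr => h; rewrite -[X in sg * X]mul1r h mulr0.
have := spokeC Cq Ca Cb0 Cb (Ct l) a1 b01 cab1 xl (divr_gt0 cbb0 cab0) (divr_gt0 cab cab0)
  (congr1 _ eb).
rewrite xq addrAC subrr add0r => -[e1|[_ sab _]|[_ sbb _]].
- by case: (qT l).
- by case: (noflat b).
have sb2 : N (b0 + b) = 2 := sbb.
have -> : a + b0 = (b0 + b) - (b - a) by vec; ring.
have := nrmB normN (b0 + b) (b - a); lra.
Qed.

Lemma cr_pos sg a : sg != 0 -> a != 0 -> exists u, 0 < cr sg a u.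
Proof.
move=> sg0 a0.
exists (\row_j (if j == ord0 then - (sg * a ord0 ord_max) else sg * a ord0 ord0)).
rewrite /cr !mxE /=.
have -> : sg * (a ord0 ord0 * (sg * a ord0 ord0) - a ord0 ord_max * - (sg * a ord0 ord_max))
  = sg ^+ 2 * (a ord0 ord0 ^+ 2 + a ord0 ord_max ^+ 2) by ring.
rewrite mulr_gt0 ?exprn_even_gt0//= lt_def addr_ge0 ?sqr_ge0// andbT.
apply: contra_neq a0 => /eqP; rewrite paddr_eq0 ?sqr_ge0// !sqrf_eq0 => /andP[/eqP h0 /eqP h1].
by apply: row2P; rewrite mxE.
Qed.

(** If the arc about [q] continues in [C] past [q + a], [apex_limit] gives a flat piece. If not,
    some disk cuts it off at [q + a]; its center is diametral to [q + a] and, by [wedge], on the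
    other side. *)
Lemma neighbor_or_flat sg q a : sg != 0 -> C q -> off_centers q -> N a = 1 -> C (q + a) ->
  (exists l, N (t l - (q + a)) = 1 /\ cr sg a (t l - (q + a)) < 0) \/
  (exists b, [/\ N b = 1, C (q + b), 0 < cr sg a b & same_face a b]).
Proof.
move=> sg0 Cq qT a1 Ca.
have [H|/existsNP[e0 /not_implyP[e00 H]]] :=
  pselect (forall e, 0 < e -> exists b, [/\ N b = 1, C (q + b), 0 < cr sg a b & N (b - a) < e]).
  by right; exact: apex_limit H.
left; have [e1 e10 gap] := fin_gap (fun l => 1 - N (q + a - t l)).
have [u cau] := cr_pos sg0 (unit_neq0 normN a1).
(* The three bounds put [q + b] outside [C], keep it in the disks not touching [q + a], and meet the
   size condition of [wedge]. *)
pose e := Num.min (Num.min e0 e1) 2^-1.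
have ep : 0 < e by rewrite !lt_min e00 e10 invr_gt0 ltr0n.
have [al [be [al0 be0 b1 bd]]] := near_unit normN u a1 ep.
move: b1 bd; set b := _ + _ => b1 bd.
have cab : 0 < cr sg a b by rewrite /b !crE mulr0 add0r mulr_gt0.
have [[be0' be1] be2] : (N (b - a) < e0 /\ N (b - a) < e1) /\ N (b - a) < 2^-1.
  by move: bd; rewrite !lt_min -!andbA => /and3P[].
have /existsNP[l /negP] : ~ forall l, N (q + b - t l) <= 1.
  by move=> h; apply: H; exists b; split=> //; exact: Cm.
rewrite -ltNge => bl.
have yl : N (q + a - t l) = 1.
  apply/eqP; rewrite eq_le Cd//= leNgt; apply/negP => lt1.
  have := gap l; rewrite subr_gt0 => /(_ lt1).
  have eb : q + b - t l = (q + a - t l) + (b - a) by vec; ring.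
  rewrite eb in bl.
  have := nrmD normN (q + a - t l) (b - a); lra.
exists l; split; first by rewrite nrmC.
rewrite ltNge; apply/negP => ctl.
have tl1 : N (t l - (q + a)) = 1 by rewrite nrmC.
have [c0|c0] := eqVneq (cr sg a (t l - (q + a))) 0.
  case: (cr_unit0 normN sg0 a1 tl1 c0) => e2.
    have := Cd (Ct l) Cq; have -> : t l - q = 2 *: a.
      by rewrite -[t l](subrK (q + a)) e2; vec; ring.
    by rewrite nrmZp// a1; lra.
  by apply: (qT l); rewrite -[t l](subrK (q + a)) e2; vec; ring.
suff : N (t l - (q + a) - (b - a)) <= 1.
  have -> : t l - (q + a) - (b - a) = - (q + b - t l) by vec; ring.
  by rewrite nrmN//; lra.
apply: (@wedge _ _ normN sg (- a)) => //.
- by rewrite nrmN.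
- have -> : - a - (t l - (q + a)) = - (t l - q) by vec; ring.
  by rewrite nrmN// Cd.
- have -> : - a - (b - a) = - b by vec; ring.
  by rewrite nrmN// b1.
- by rewrite crNl crBr crxx; lra.
- by rewrite crNl oppr_lt0 lt_def c0.
- exact: ltW.
Qed.

Lemma nrm_sum (I : finType) (P : pred I) (f : I -> 'rV[R]_2) :
  N (\sum_(i | P i) f i) <= \sum_(i | P i) N (f i).
Proof.
elim/big_ind2: _ => [|x k y l hx hy|i _] //; first by rewrite nrm0.
by apply: le_trans (nrmD normN _ _) _; exact: lerD.
Qed.

(* The centroid works: among the [m] distances averaged, one vanishes. *)
Lemma center_exists : exists c, forall i, N (c - t i) < 1.
Proof.
exists (m%:R^-1 *: \sum_j t j) => i.
have m0 : 0 < m%:R :> R by rewrite ltr0n (leq_ltn_trans _ (ltn_ord i)).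
have -> : m%:R^-1 *: \sum_j t j - t i = m%:R^-1 *: \sum_j (t j - t i).
  rewrite sumrB scalerBr sumr_const card_ord -(scaler_nat _ (t i)) scalerA mulVf ?scale1r//.
  by rewrite gt_eqF.
have mi0 : 0 <= m%:R^-1 :> R by rewrite invr_ge0 ltW.
rewrite nrmZp// ltr_pdivrMl// mulr1.
apply: le_lt_trans (nrm_sum _ _) _; rewrite (bigD1 i)//= subrr nrm0// add0r.
apply: (@le_lt_trans _ _ (\sum_(j < m | j != i) 1)).
  by apply: ler_sum => j _; exact: Cd.
by rewrite sumr_const ltr_nat cardC1 card_ord; case: m i => [[]|].
Qed.

(** On the way from an interior point to [p], only the disk of [t i] is left; at the exit point [z]
    a small rotation about [t i] avoids the finitely many centers. *)
Lemma private_exists i p : (forall j, j != i -> N (p - t j) <= 1) -> 1 < N (p - t i) ->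
  exists z, [/\ C z, N (z - t i) = 1, forall j, j != i -> N (z - t j) < 1 &
                forall l, z <> t l].
Proof.
move=> pj pi; have [c ct] := center_exists.
pose f (s : R) : R := N (c + s *: (p - c) - t i).
have fc : continuous f.
  move=> s; apply: (@continuous_comp _ _ _ (fun s : R => c + s *: (p - c) - t i) N).
    apply: cvgB; last exact: cvg_cst.
    by apply: cvgD; [exact: cvg_cst | apply: cvgZr_tmp; exact: cvg_id].
  exact: nrm_continuous.
have f0 : f 0 < 1 by rewrite /f scale0r addr0.
have f1 : 1 < f 1 by rewrite /f; have -> : c + 1 *: (p - c) - t i = p - t i by vec; ring.
have fv : Num.min (f 0) (f 1) <= 1 <= Num.max (f 0) (f 1).
  by rewrite ge_min le_max (ltW f0) (ltW f1) orbT.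
have [s] := IVT ler01 (continuous_subspaceT fc) fv.
rewrite in_itv/= => /andP[s0 s1] fs.
have s1' : s < 1.
  by rewrite lt_neqAle s1 andbT; apply/eqP => e; move: f1; rewrite -[X in f X]e fs ltxx.
move: fs; rewrite /f; set z := c + _ => zi.
have zj j : j != i -> N (z - t j) < 1.
  move=> ji; have -> : z - t j = (1 - s) *: (c - t j) + s *: (p - t j).
    by rewrite /z; vec; ring.
  apply: le_lt_trans (nrm_lin normN _ _ _ s0) _; first by rewrite subr_ge0.
  by have := ct j; have := pj _ ji; nra.
have [e1 e10 h1] := fin_gap (fun j => 1 - N (z - t j)).
have [e2 e20 h2] := fin_gap (fun j => N (z - t j)).
have [u cu] := cr_pos (oner_neq0 R) (unit_neq0 normN zi).
have e0 : 0 < Num.min e1 e2 by rewrite lt_min e10.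
have [al [be [al0 be0 w1 wd]]] := near_unit normN u zi e0.
move: w1 wd; set w := _ + _ => w1; rewrite lt_min => /andP[wd1 wd2].
have cw : 0 < cr 1 (z - t i) w by rewrite /w crDr !crZr crxx mulr0 add0r mulr_gt0.
have dz j : t i + w - t j = (z - t j) + (w - (z - t i)) by vec; ring.
have wj j : j != i -> N (t i + w - t j) < 1.
  move=> ji; rewrite dz; apply: le_lt_trans (nrmD normN _ _) _.
  by have := h1 j; rewrite subr_gt0 => /(_ (zj j ji)); lra.
exists (t i + w); split=> //.
- apply: Cm => j; have [->|ji] := eqVneq j i; last by rewrite ltW// wj.
  by rewrite addrAC subrr add0r w1.
- by rewrite addrAC subrr add0r.
move=> l e; have [zl|zl] := eqVneq (N (z - t l)) 0.
  have ezl : z = t l by apply/eqP; rewrite -subr_eq0; apply/eqP; exact: nrm0_eq0 zl.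
  have ew : w = z - t i by rewrite ezl -e addrAC subrr add0r.
  by move: cw; rewrite {1}ew crxx ltxx.
have := h2 l; rewrite lt_def zl nrm_ge0// => /(_ isT).
have : N (z - t l) = N (w - (z - t i)).
  by rewrite -e -nrmN//; congr N; vec; ring.
lra.
Qed.

(** * Diametral neighbors of a center on either side of its chord *)

Variable q : 'I_m -> 'rV[R]_2.
Hypothesis Cq : forall i, C (q i).
Hypothesis qt : forall i, N (q i - t i) = 1.
Hypothesis qpriv : forall i j, j != i -> N (q i - t j) < 1.
Hypothesis qoff : forall i, off_centers (q i).

Lemma sg_opp sg : sg != 0 -> - sg != 0. Proof. by rewrite oppr_eq0. Qed.

Lemma tq i : N (t i - q i) = 1. Proof. by rewrite nrmC. Qed.

Lemma qpriv_eq i j : N (q i - t j) = 1 -> j = i.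
Proof. by move=> h; apply/eqP/negP => /negP/qpriv; rewrite h ltxx. Qed.

(** [neighbor_or_flat] at [q i] gives the neighbor, unless the arc about [q i] starts with a segment
    in a direction [e]. Then the last point [c] of [C] on the ray from [q i] along [- e] is a center
    and the neighbor sought. *)
Lemma left_nbr sg i : sg != 0 ->
  exists l, N (t l - t i) = 1 /\ 0 < cr sg (q i - t i) (t l - t i).
Proof.
move=> sg0; have [a ea] : exists a, a = t i - q i by exists (t i - q i).
have a1 : N a = 1 by rewrite ea tq.
have eqa : q i + a = t i by rewrite ea; vec; ring.
have Cqa : C (q i + a) by rewrite eqa.
have va : q i - t i = - a by rewrite ea opprB.
case: (neighbor_or_flat sg0 (Cq i) (@qoff i) a1 Cqa).
  rewrite eqa => -[l [h1 h2]]; exists l; split => //.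
  by rewrite va crNl oppr_gt0.
move=> [b0 [b01 Cb0 cab0 sab0]].
have ab0 : a != b0 by apply/eqP => e; move: cab0; rewrite e crxx ltxx.
have [e ee] : exists e, e = b0 - a by exists (b0 - a).
have e0 : e != 0 by rewrite ee subr_eq0 eq_sym.
have cae : 0 < cr sg a e by rewrite ee crBr crxx; lra.
(* The chord of [i] is tilted within its face as far as [C] allows; [b] and [c] are the extreme
   ends. *)
have [T0 [T00 CT maxT]] := line_ext Cqa e0.
have eN0 : - e != 0 by rewrite oppr_eq0.
have [K0 [K00 CK maxK]] := line_ext (Cq i) eN0.
have T1 : 1 <= T0.
  by apply: maxT; rewrite scale1r; have -> : q i + a + e = q i + b0 by rewrite ee; vec; ring.
move: CT CK; set b := _ + T0 *: e; set c := _ + K0 *: _ => CT CK.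
have on_line k x y : C x -> C y -> x - y = a + k *: e -> N (x - y) = 1 /\ same_face a (x - y).
  by move=> Cx Cy e1; have := Cd Cx Cy; rewrite e1 ee; exact: same_face_on.
have lineP w : N w = 1 -> same_face a w -> exists k, w = a + k *: e.
  by move=> w1; rewrite ee; exact: same_face_line.
have etc : t i - c = a + K0 *: e by rewrite -eqa /c; vec; ring.
have ebc : b - c = a + (T0 + K0) *: e by rewrite /b /c; vec; ring.
have [tc1 _] := on_line _ _ _ (Ct i) CK etc.
have [bc1 sbc] := on_line _ _ _ CT CK ebc.
have cb1 : N (c - b) = 1 by rewrite nrmC.
have [[l cl]|cT] := pselect (exists l, c = t l).
  have K1 : 0 < K0.
    rewrite lt_def K00 andbT; apply/eqP => K000; apply: (@qoff i l).
    by rewrite -cl /c K000 scale0r addr0.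
  exists l; rewrite -cl; split; first by rewrite nrmC.
  have -> : cr sg (q i - t i) (c - t i) = K0 * cr sg a e.
    by rewrite -(opprB (t i) c) etc va crNl crNr opprK crDr crZr crxx add0r.
  exact: mulr_gt0.
have coff : off_centers c by move=> l cl; apply: cT; exists l.
have crl k k' : cr sg (a + k *: e) (a + k' *: e) = (k' - k) * cr sg a e.
  by rewrite !crE (crC _ a e); ring.
(* A flat continuation about [b] would contain a point of [C] beyond [c]. *)
have noturn w : N w = 1 -> C (b + w) -> 0 < cr sg (c - b) w -> same_face (c - b) w -> False.
  move=> w1 Cw cw sw; have [k ek] : exists k, - w = a + k *: e.
    apply: lineP; first by rewrite nrmN.
    apply: (same_face_trans normN nangled a1 bc1 _ sbc); first by rewrite nrmN.
    by apply: same_faceN; rewrite // opprK opprB.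
  move: cw; rewrite -(opprK w) ek crNr -crNl opprB ebc crl pmulr_lgt0// subr_gt0.
  apply/negP; rewrite -leNgt -lerBlDl; apply: maxK.
  suff -> : q i + (k - T0) *: - e = b + w by [].
  by rewrite -[w]opprK ek /b; vec; ring.
have Cbc : C (c + (b - c)) by rewrite addrC subrK.
(* Now [c] is not a center. A flat arc about [c] would go beyond [b]; a neighbor of [b] spans an arc
   about [b] by [fanC], which [apex_limit] and [noturn] rule out. *)
case: (neighbor_or_flat sg0 CK coff bc1 Cbc); last first.
  move=> [b1 [b11 Cb1 cb sb]].
  have [k ek] := lineP _ b11 (same_face_trans normN nangled a1 bc1 b11 sbc sb).
  exfalso; move: cb; rewrite ebc ek crl pmulr_lgt0// subr_gt0.
  apply/negP; rewrite -leNgt -lerBlDr; apply: maxT.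
  suff -> : q i + a + (k - K0) *: e = c + b1 by [].
  by rewrite ek /c; vec; ring.
rewrite [c + _]addrC subrK => -[l [tl1 cl]]; exfalso.
have ctl : 0 < cr sg (c - b) (t l - b) by rewrite -(opprB b c) crNl oppr_gt0.
(* A center at [b] would be diametral to [q i], hence equal to [t i], against [1 <= T0]. *)
have boff : off_centers b.
  move=> l' bl'.
  have : N (b - q i) = 1.
    by apply: (on_line T0 _ _ CT (Cq i) _).1; rewrite /b; vec; ring.
  rewrite nrmC// bl' => /qpriv_eq il; move: bl'; rewrite il -eqa /b => /eqP.
  rewrite -subr_eq0 addrAC subrr add0r scaler_eq0 (negbTE e0) orbF => /eqP; lra.
have Cbcb : C (b + (c - b)) by rewrite addrC subrK.
have Cbt : C (b + (t l - b)) by rewrite addrC subrK.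
have [] := apex_limit sg0 CT boff cb1 Cbcb; last first.
  by move=> w [w1 Cw cw sw]; exact: noturn sw.
move=> d d0; have [al [be [al0 be0 w1 wd]]] := near_unit normN (t l - b) cb1 d0.
exists (al *: (c - b) + be *: (t l - b)); split => //.
  exact: fanC (lt0r_neq0 ctl) CT Cbcb Cbt cb1 tl1 w1 al0 be0 erefl.
by rewrite crDr !crZr crxx mulr0 add0r mulr_gt0.
Qed.

Local Notation vv i := (q i - t i).

Lemma t_inj i j : t i = t j -> i = j.
Proof. by move=> e; apply: (@qpriv_eq j i); rewrite e qt. Qed.

Lemma dist0F i : N (t i - t i) = 1 -> False.
Proof. by rewrite subrr nrm0//; lra. Qed.

(** A point strictly inside the chord would be at distance 1 from a center [t l]; this fails by
    convexity, as [q i] is closer than 1 to every [t l] with [l != i]. *)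
Lemma diametral_on_chord sg i x y : sg != 0 -> C x -> C y -> N (x - y) = 1 ->
  cr sg (vv i) (x - t i) = 0 -> x = t i \/ x = q i.
Proof.
move=> sg0 Cx Cy xy /(cr_parallel sg0 (unit_neq0 normN (qt i)))[k ek].
have k1 : `|k| <= 1 by have := Cd Cx (Ct i); rewrite ek nrmZ// qt mulr1.
have k2 : `|k - 1| <= 1.
  have := Cd Cx (Cq i); have -> : x - q i = (k - 1) *: vv i.
    by rewrite -[x in LHS](subrK (t i)) ek; vec; ring.
  by rewrite nrmZ// qt mulr1.
have [k00 k11] : 0 <= k /\ k <= 1 by move: k1 k2; rewrite !ler_norml; lra.
have [k0|k0] := eqVneq k 0.
  by left; apply/eqP; rewrite -subr_eq0 ek k0 scale0r.
have [k1'|k1'] := eqVneq k 1.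
  by right; rewrite -[x](subrK (t i)) ek k1' scale1r subrK.
have kp : 0 < k by rewrite lt_def k0.
have km : k < 1 by rewrite lt_neqAle k1'.
have [l xl] := diametral_center Cx Cy xy; exfalso.
have [li|li] := eqVneq l i.
  by move: xl; rewrite li ek nrmZ// qt ger0_norm//; lra.
have := qpriv li => ql.
have : N (x - t l) <= (1 - k) * N (t i - t l) + k * N (q i - t l).
  have -> : x - t l = (1 - k) *: (t i - t l) + k *: (q i - t l).
    by rewrite -[x in LHS](subrK (t i)) ek; vec; ring.
  by apply: nrm_lin => //; lra.
have := Cd (Ct i) (Ct l); rewrite xl; nra.
Qed.

Lemma center_off_chord sg i j : sg != 0 -> j != i -> cr sg (vv i) (t j - t i) != 0.
Proof.
move=> sg0 ji; apply/eqP => /(diametral_on_chord sg0 (Ct j) (Cq j) (tq j))[/t_inj e|].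
  by move: ji; rewrite e eqxx.
by move=> e; apply: (@qoff i j).
Qed.

(** The two diametral chords cross: by [rect], a common face would make another center diametral to
    [q i]. *)
Lemma opp_sides sg i j l : sg != 0 -> j != i -> l != i -> N (t j - t l) = 1 ->
  cr sg (vv i) (t j - t i) * cr sg (vv i) (t l - t i) < 0.
Proof.
move=> sg0 ji li jl; have cj := center_off_chord sg0 ji; have cl := center_off_chord sg0 li.
case: (crossC (Ct j) (Ct l) (Cq i) (Ct i) jl (qt i)).
- move=> s; have [_ h _ _] := rectC (Ct j) (Ct l) (Cq i) (Ct i) jl (qt i) s.
  by move: li; rewrite (qpriv_eq h) eqxx.
- move=> s; have [h _ _ _] := rectC (Ct j) (Ct l) (Ct i) (Cq i) jl (tq i) s.
  by rewrite nrmC// in h; move: ji; rewrite (qpriv_eq h) eqxx.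
move=> [s [ta [s0 s1 _ _ e]]].
have : cr sg (vv i) (t l + s *: (t j - t l) - t i) = 0.
  by rewrite e addrAC subrr add0r crZr crxx mulr0.
have -> : t l + s *: (t j - t l) - t i = (1 - s) *: (t l - t i) + s *: (t j - t i).
  by vec; ring.
move: cl cj; rewrite [cr _ _ (_ *: _ + _)]crDr !crZr.
set X := cr _ _ (t l - t i); set Y := cr _ _ (t j - t i) => cl cj h.
have [lt0|gt0|/eqP] := ltgtP (Y * X) 0 => //; last by rewrite mulf_eq0 (negbTE cl) (negbTE cj).
exfalso.
have X2 : 0 < X ^+ 2 by rewrite exprn_even_gt0.
have : (1 - s) * X ^+ 2 + s * (Y * X) = 0.
  have -> : (1 - s) * X ^+ 2 + s * (Y * X) = ((1 - s) * X + s * Y) * X by ring.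
  by rewrite h mul0r.
nra.
Qed.

(** Otherwise the chords of [i] and [j] lie on opposite sides of the line through [t i] and [t j]
    and cannot cross. If they are flat with opposite directions, the chord from [t i] to its other
    neighbor replaces that of [i]. *)
Lemma nbr_sym sg i j : sg != 0 -> N (t j - t i) = 1 ->
  0 < cr sg (vv i) (t j - t i) -> cr sg (vv j) (t i - t j) < 0.
Proof.
move=> sg0 ij c; have ij0 : i != j by apply/eqP => e; apply: (@dist0F i); rewrite {1}e.
have ji : N (t i - t j) = 1 by rewrite nrmC.
have cj := center_off_chord sg0 ij0.
rewrite lt_neqAle cj /= leNgt; apply/negP => {cj} cj.
have [w ew] : exists w, w = t j - t i by exists (t j - t i).
have cwi : cr sg w (vv i) < 0 by rewrite crC ew oppr_lt0.
have cwj : 0 < cr sg w (vv j) by rewrite crC -crNr ew opprB.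
have meetF s ta x : 0 <= s -> 0 <= ta -> cr sg w (x - t i) < 0 ->
    t i + s *: (x - t i) = t j + ta *: vv j -> False.
  move=> s0 ta0 cx e.
  have : cr sg w (s *: (x - t i)) = cr sg w (w + ta *: vv j).
    by congr cr; rewrite ew; apply: (addrI (t i)); rewrite e; vec; ring.
  rewrite crDr !crZr crxx add0r => h.
  have s00 : s = 0 by nra.
  have ta00 : ta = 0 by nra.
  move: e; rewrite s00 ta00 !scale0r !addr0 => /t_inj e.
  by move: ij0; rewrite e eqxx.
case: (crossC (Cq i) (Ct i) (Cq j) (Ct j) (qt i) (qt j)).
- move=> s; have [h _ _ _] := rectC (Cq i) (Ct i) (Cq j) (Ct j) (qt i) (qt j) s.
  by move: ij0; rewrite (qpriv_eq h) eqxx.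
- move=> sij.
  have [l [li cl]] := left_nbr i (sg_opp sg0).
  rewrite crN oppr_gt0 in cl.
  have li0 : l != i by apply/eqP => e; apply: (@dist0F i); rewrite -{1}e.
  have lj : l != j by apply/eqP => e; move: c; rewrite -e ltNge ltW.
  case: (crossC (Ct l) (Ct i) (Cq j) (Ct j) li (qt j)).
  + move=> s; have [_ h _ _] := rectC (Ct l) (Ct i) (Cq j) (Ct j) li (qt j) s.
    by move: ij0; rewrite (qpriv_eq h) eqxx.
  + move=> s; have [h _ _ _] := rectC (Ct l) (Ct i) (Ct j) (Cq j) li (tq j) s.
    by rewrite nrmC// in h; move: lj; rewrite (qpriv_eq h) eqxx.
  + move=> [s [ta [s0 s1 ta0 ta1 e]]]; apply: meetF s0 ta0 _ e.
    rewrite ew; apply: (@between_lt _ _ normN sg (vv i)) => //.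
    * by rewrite opprB addrA subrK Cd.
    * by rewrite opprB addrA subrK Cd.
    * by rewrite opprB addrA subrK Cd.
    * exact: ltW.
- by move=> [s [ta [s0 s1 ta0 ta1 e]]]; apply: meetF s0 ta0 _ e.
Qed.

(** By [nbr_sym], the chord of [a] and the chord from [t j] to [t b] lie on opposite sides of the
    line through [t j] and [t a], so they cannot cross. *)
Lemma nbr_uniq_aux sg j (a b : 'I_m) : sg != 0 -> a != b ->
  N (t a - t j) = 1 -> N (t b - t j) = 1 ->
  0 < cr sg (vv j) (t a - t j) -> 0 < cr sg (t a - t j) (t b - t j) -> False.
Proof.
move=> sg0 ab aj bj ca cab.
have ja : j != a by apply/eqP => e; apply: (@dist0F a); rewrite -{2}e.
have := nbr_sym sg0 aj ca; rewrite -(opprB (t a) (t j)) crNr oppr_lt0 => cva.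
case: (crossC (Cq a) (Ct a) (Ct b) (Ct j) (qt a) bj).
- move=> s; have [h _ _ _] := rectC (Cq a) (Ct a) (Ct b) (Ct j) (qt a) bj s.
  by move: ja; rewrite (qpriv_eq h) eqxx.
- move=> s; have jb : N (t j - t b) = 1 by rewrite nrmC.
  have [h _ _ _] := rectC (Cq a) (Ct a) (Ct j) (Ct b) (qt a) jb s.
  by move: ab; rewrite (qpriv_eq h) eqxx.
move=> [s [ta [s0 s1 ta0 ta1 e]]].
have : cr sg (t a - t j) (s *: vv a) = cr sg (t a - t j) (ta *: (t b - t j) - (t a - t j)).
  by congr cr; apply: (addrI (t a)); rewrite e; vec; ring.
rewrite crBr !crZr crxx subr0 (crC _ (vv a)) => h.
have s00 : s = 0 by nra.
have ta00 : ta = 0 by nra.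
move: e; rewrite s00 ta00 !scale0r !addr0 => /t_inj e.
by move: ja; rewrite e eqxx.
Qed.

Lemma nbr_uniq sg j (a b : 'I_m) : sg != 0 ->
  N (t a - t j) = 1 -> N (t b - t j) = 1 ->
  0 < cr sg (vv j) (t a - t j) -> 0 < cr sg (vv j) (t b - t j) -> a = b.
Proof.
move=> sg0 aj bj ca cb; apply/eqP/negP => /negP ab.
have [c|c|c] := ltgtP (cr sg (t a - t j) (t b - t j)) 0.
- rewrite crC oppr_lt0 in c.
  by apply: (nbr_uniq_aux sg0 _ bj aj cb c); rewrite eq_sym.
- exact: (nbr_uniq_aux sg0 ab aj bj ca c).
have [e|e] := cr_unit0 normN sg0 aj bj c.
  by move: ab; rewrite (t_inj (addIr _ e)) eqxx.
by move: cb; rewrite e crNr oppr_gt0 ltNge ltW.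
Qed.

Lemma cr_neq0 sg a b : cr sg a b != 0 -> cr 1 a b != 0.
Proof. by apply: contra_neq; rewrite /cr mul1r => ->; rewrite mulr0. Qed.

(** * Diametral endpoints on the same side of two consecutive chords *)

Section Gap.
Variables (sg : R) (a b : 'I_m) (x y : 'rV[R]_2).
Hypotheses (sg0 : sg != 0) (Cx : C x) (Cy : C y) (xy : N (x - y) = 1).
Hypotheses (ba : N (t b - t a) = 1) (cab : 0 < cr sg (vv a) (t b - t a)).
Hypotheses (xa : cr sg (vv a) (x - t a) <= 0) (xb : cr sg (vv b) (x - t b) <= 0).

(** [x] lies in the cone at [t b] spanned by [t a] and [q b]. Inside the cone [spokeC] applies; on
    its boundary [x] can only be [q b] or [t a]. *)
Lemma gap_center : N (x - t b) = 1.
Proof.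
have ab : N (t a - t b) = 1 by rewrite nrmC.
have cba := nbr_sym sg0 ba cab.
have cw : 0 < cr sg (t a - t b) (vv b) by rewrite crC oppr_gt0.
have ex := cr_decomp (x - t b) (lt0r_neq0 cw).
have btwx : cr sg (t b - t a) (x - t a) <= 0.
  by apply: (@between_le _ _ normN sg (vv a)) => //; rewrite opprB addrA subrK Cd.
have cwx : 0 <= cr sg (t a - t b) (x - t b).
  have -> : x - t b = (x - t a) + (t a - t b) by vec; ring.
  by rewrite crDr crxx addr0 -(opprB (t b) (t a)) crNl oppr_ge0.
have cxw : 0 <= cr sg (x - t b) (vv b) by rewrite crC oppr_ge0.
have [xb0|xb0] := eqVneq (cr sg (x - t b) (vv b)) 0.
  have := xb0; rewrite crC => /eqP; rewrite oppr_eq0 => /eqP.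
  case/(diametral_on_chord sg0 Cx Cy xy) => e; last by rewrite e qt.
  by move: xa; rewrite e leNgt cab.
have [xw0|xw0] := eqVneq (cr sg (t a - t b) (x - t b)) 0.
  move: ex; rewrite xw0 mul0r scale0r addr0; set k := _ / _ => ex.
  have k0 : 0 <= k by rewrite divr_ge0// ltW.
  have k1 : k <= 1 by have := Cd Cx (Ct b); rewrite ex nrmZp// ab mulr1.
  have : cr sg (vv a) (x - t a) = (1 - k) * cr sg (vv a) (t b - t a).
    have -> : x - t a = (1 - k) *: (t b - t a).
      have -> : x - t a = (x - t b) - (t a - t b) by vec; ring.
      by rewrite ex; vec; ring.
    by rewrite crZr.
  move=> e; have xa' := xa; rewrite e in xa'; have -> : x - t b = t a - t b => //.
  rewrite ex -[RHS]scale1r; congr (_ *: _).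
  by move: xa'; rewrite pmulr_lle0//; lra.
have [l xl] := diametral_center Cx Cy xy.
have al0 : 0 < cr sg (x - t b) (vv b) / cr sg (t a - t b) (vv b).
  by rewrite divr_gt0// lt_def xb0.
have be0 : 0 < cr sg (t a - t b) (x - t b) / cr sg (t a - t b) (vv b).
  by rewrite divr_gt0// lt_def xw0.
have ea : t b + (t a - t b) = t a by rewrite addrC subrK.
have eqb : t b + (q b - t b) = q b by rewrite addrC subrK.
have ex' : x = t b + ((cr sg (x - t b) (vv b) / cr sg (t a - t b) (vv b)) *: (t a - t b) +
    (cr sg (t a - t b) (x - t b) / cr sg (t a - t b) (vv b)) *: vv b).
  by rewrite -ex addrC subrK.
have Ca : C (t b + (t a - t b)) by rewrite ea.
have Cqb : C (t b + vv b) by rewrite eqb.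
case: (spokeC (Ct b) Ca Cqb Cx (Ct l) ab (qt b) (cr_neq0 (lt0r_neq0 cw)) xl al0 be0 ex').
- by move=> <-.
- by case.
- by case.
Qed.

(** The chord from [x] to [t b] is diametral by [gap_center], so it crosses the chord of [c], as
    does the one from [t a] to [t b]; thus [x] and [t a] are both opposite to [t b]. *)
Lemma gap_side c : c != a -> c != b ->
  0 < cr sg (vv c) (x - t c) * cr sg (vv c) (t a - t c).
Proof.
move=> ca cb; have xtb := gap_center.
have ab : N (t a - t b) = 1 by rewrite nrmC.
have ac : a != c by rewrite eq_sym.
have bc : b != c by rewrite eq_sym.
have opp := opp_sides sg0 ac bc ab.
have cba := nbr_sym sg0 ba cab.
have uniq : N (t c - t b) = 1 -> 0 < cr sg (vv b) (t c - t b).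
  move=> tcb; have := center_off_chord sg0 cb; rewrite neq_lt => /orP[lt0|//].
  have h : c = a.
    by apply: (nbr_uniq (sg_opp sg0) tcb ab); rewrite crN oppr_gt0.
  by move: ca; rewrite h eqxx.
case: (crossC Cx (Ct b) (Cq c) (Ct c) xtb (qt c)).
- move=> s; have [_ h _ _] := rectC Cx (Ct b) (Cq c) (Ct c) xtb (qt c) s.
  by move: cb; rewrite (qpriv_eq h) eqxx.
(* In this flat case [t c] is the neighbor of [t b] on the side away from [t a], and the side of [x]
   is computed along the common face. *)
- move=> s; have [xq tcb _ s2] := rectC Cx (Ct b) (Ct c) (Cq c) xtb (tq c) s.
  have ctc := uniq tcb.
  have lt0 := nbr_sym sg0 tcb ctc.
  have side : cr sg (t c - t b) (x - t b) < 0.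
    by apply: (@between_lt _ _ normN sg (vv b)) => //; rewrite opprB addrA subrK Cd.
  have nx : t c - t b != x - t b.
    by apply/eqP => e; move: side; rewrite e crxx ltxx.
  have s3 : same_face (t c - t b) (t c - q c) :=
    same_face_trans normN nangled tcb xtb (tq c) (same_faceC s2) s.
  have [k ek] := same_face_line normN nangled tcb xtb (tq c) nx (same_faceC s2) s3.
  have -> : cr sg (vv c) (x - t c) = - cr sg (t c - t b) (x - t b).
    rewrite -(opprB (t c) (q c)) ek.
    have -> : x - t c = (x - t b) - (t c - t b) by vec; ring.
    by move: (t c - t b) (x - t b) => w xi; rewrite /cr !mxE; ring.
  nra.
move=> [s [ta [s0 s1 ta0 ta1 e]]].
have : cr sg (vv c) (t b + s *: (x - t b) - t c) = 0.
  by rewrite e addrAC subrr add0r crZr crxx mulr0.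
have -> : t b + s *: (x - t b) - t c = (1 - s) *: (t b - t c) + s *: (x - t c).
  by vec; ring.
rewrite [cr _ _ (_ *: _ + _)]crDr !crZr => h.
have xc : cr sg (vv c) (x - t c) != 0.
  apply/eqP => /(diametral_on_chord sg0 Cx Cy xy)[] ex.
    by rewrite ex in xtb; have := uniq xtb; rewrite -ex ltNge xb.
  by rewrite ex in xtb; move: cb; rewrite (qpriv_eq xtb) eqxx.
have tbc := center_off_chord sg0 bc.
move: opp h xc tbc; set X := cr _ _ (x - t c); set B := cr _ _ (t b - t c).
set A := cr _ _ (t a - t c) => opp h xc tbc.
have s00 : 0 < s.
  rewrite lt_def s0 andbT; apply: contra_neq tbc => s00.
  by move: h; rewrite s00 mul0r addr0 subr0 mul1r.
have : 0 < X ^+ 2 by rewrite exprn_even_gt0.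
have : 0 < B ^+ 2 by rewrite exprn_even_gt0.
move=> B2 X2.
have BX : s * (B * X) = - ((1 - s) * B ^+ 2).
  have -> : s * (B * X) = B * ((1 - s) * B + s * X) - (1 - s) * B ^+ 2 by ring.
  by rewrite h mulr0 sub0r.
have BX0 : B * X <= 0 by rewrite -(pmulr_rle0 _ s00) BX oppr_le0 mulr_ge0 ?sqr_ge0 ?subr_ge0.
have BXn : B * X != 0 by rewrite mulf_neq0.
have BXl : B * X < 0 by rewrite lt_neqAle BXn.
rewrite -(pmulr_rgt0 _ B2).
have -> : B ^+ 2 * (X * A) = (B * X) * (A * B) by ring.
by rewrite nmulr_rgt0.
Qed.

End Gap.

(** * Private points in general position *)

Lemma nonflat_mid u1 u2 : N u1 = 1 -> N u2 = 1 -> cr 1 u1 u2 != 0 -> ~ same_face u1 u2 ->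
  exists al be, [/\ 0 < al, 0 < be, N (al *: u1 + be *: u2) = 1,
    ~ same_face u1 (al *: u1 + be *: u2) & ~ same_face u2 (al *: u1 + be *: u2)].
Proof.
move=> n1 n2 c12 ns.
pose p (k : R) : 'rV[R]_2 := (1 - k) *: u1 + k *: u2.
(* The zero of [h] gives a direction [w] with [N (u1 + w) = N (u2 + w)]; sharing a face with one of
   [u1], [u2] it would share it with both. The factor [N (p k)] avoids a division, so continuity is
   immediate. *)
pose h (k : R) : R := N (N (p k) *: u1 + p k) - N (N (p k) *: u2 + p k).
have pc : continuous p.
  move=> k; apply: cvgD; apply: cvgZr_tmp; last exact: cvg_id.
  by apply: cvgB; [exact: cvg_cst | exact: cvg_id].
have npc : continuous (N \o p).
  by move=> k; apply: continuous_comp; [exact: pc | exact: nrm_continuous].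
have hc : continuous h.
  have c1 u : continuous (fun k => N (N (p k) *: u + p k)).
    move=> k; apply: (@continuous_comp _ _ _ (fun k => N (p k) *: u + p k) N).
      by apply: cvgD; [apply: cvgZr_tmp; exact: npc | exact: pc].
    exact: nrm_continuous.
  by move=> k; apply: cvgB; exact: c1.
have n12 : N (u1 + u2) <= 2 by have := nrmD normN u1 u2; lra.
have h0 : h 0 = 2 - N (u1 + u2).
  rewrite /h /p subr0 scale1r scale0r addr0 n1 !scale1r [u2 + u1]addrC.
  by rewrite (same_face_refl normN n1).
have h1 : h 1 = N (u1 + u2) - 2.
  by rewrite /h /p subrr scale1r scale0r add0r n2 !scale1r (same_face_refl normN n2).
have hv : Num.min (h 0) (h 1) <= 0 <= Num.max (h 0) (h 1).
  by rewrite h0 h1 ge_min le_max; apply/andP; split; apply/orP; [right | left]; lra.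
have [k] := IVT ler01 (continuous_subspaceT hc) hv.
rewrite in_itv/= => /andP[k0 k1] hk.
have p0 : p k != 0.
  apply/eqP => pk; have : cr 1 u1 (p k) = 0 /\ cr 1 (p k) u2 = 0.
    by rewrite pk /cr !mxE; split; ring.
  have -> : cr 1 u1 (p k) = k * cr 1 u1 u2 by rewrite /p crDr !crZr crxx; ring.
  have -> : cr 1 (p k) u2 = (1 - k) * cr 1 u1 u2 by rewrite /p crDl !crZl crxx; ring.
  move=> [/eqP + e2]; rewrite mulf_eq0 (negbTE c12) orbF => /eqP k00.
  by move: e2; rewrite k00 subr0 mul1r => e2; rewrite e2 eqxx in c12.
have np := nrm_gt0 normN p0.
have ew u : N (p k) *: u + p k = N (p k) *: (u + (N (p k))^-1 *: p k).
  by rewrite scalerDr scalerA mulfV ?scale1r// gt_eqF.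
have [w ewd] : exists w, w = (N (p k))^-1 *: p k by exists ((N (p k))^-1 *: p k).
have w1 : N w = 1 by rewrite ewd nrmZp ?mulVf ?gt_eqF// invr_ge0 ltW.
have eqN : N (u1 + w) = N (u2 + w).
  move: hk; rewrite /h !ew -ewd !nrmZ// -mulrBr => /eqP; rewrite mulf_eq0 normr_eq0 gt_eqF//=.
  by rewrite subr_eq0 => /eqP.
have ns1 : ~ same_face u1 w.
  move=> s1; have s2 : same_face u2 w := etrans (esym eqN) s1.
  apply: ns; apply: (same_face_trans normN nangled n1 w1 n2 s1); exact: same_faceC.
have ns2 : ~ same_face u2 w by move=> s2; apply: ns1; exact: etrans eqN s2.
have ew' : w = ((1 - k) / N (p k)) *: u1 + (k / N (p k)) *: u2.
  by rewrite ewd [X in _ *: X]/p; vec; ring.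
exists ((1 - k) / N (p k)), (k / N (p k)); rewrite -ew'; split=> //.
  rewrite divr_gt0// subr_gt0 lt_neqAle k1 andbT; apply/eqP => kk.
  apply: ns2; rewrite ewd /p kk subrr scale0r add0r scale1r n2 invr1 scale1r.
  exact: same_face_refl.
rewrite divr_gt0// lt_def k0 andbT; apply/eqP => kk.
apply: ns1; rewrite ewd /p kk subr0 scale0r addr0 scale1r n1 invr1 scale1r.
exact: same_face_refl.
Qed.

Definition private i z :=
  [/\ C z, N (z - t i) = 1, forall j, j != i -> N (z - t j) < 1 & off_centers z].

(* A private point that is not good may be traded for a good one whenever the chord of
   [i] shares a face with the chord of another center; see [flat_good]. *)
Definition good i z := forall c, N (t c - t i) = 1 -> ~ same_face (z - t i) (t c - t i).

(** Here [t j] is a neighbor of [i] in the face of its chord, and the neighbor [t l] on the other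
    side is not in that face. A direction from [nonflat_mid] between [q i] and [t l] gives a private
    point, good because [i] has no neighbors besides [j] and [l]. *)
Lemma flat_good i j : same_face (vv i) (t j - q j) ->
  ~ good i (q i) /\ exists2 z, private i z & good i z.
Proof.
move=> sij; have [qq tji _ sit] := rectC (Cq i) (Ct i) (Ct j) (Cq j) (qt i) (tq j) sij.
split; first by move=> /(_ j tji).
have ji : j != i by apply/eqP => e; apply: (@dist0F i); rewrite -{1}e.
have [sg [sg0 cj]] : exists sg, sg != 0 /\ 0 < cr sg (vv i) (t j - t i).
  have := center_off_chord (oner_neq0 R) ji; rewrite neq_lt => /orP[c|c]; last by exists 1.
  by exists (-1); rewrite oppr_eq0 oner_eq0 crN oppr_gt0.
have [l [li cl]] := left_nbr i (sg_opp sg0).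
have li0 : l != i by apply/eqP => e; apply: (@dist0F i); rewrite -{1}e.
have lj : l != j.
  by apply/eqP => e; move: cl; rewrite e crN oppr_gt0 ltNge ltW.
have nsl : ~ same_face (vv i) (t l - t i).
  move=> sl; have s := same_face_trans normN nangled li (qt i) (tq j) (same_faceC sl) sij.
  have [h _ _ _] := rectC (Ct l) (Ct i) (Ct j) (Cq j) li (tq j) s.
  by rewrite nrmC// in h; move: lj; rewrite (qpriv_eq h) eqxx.
have c1 := cr_neq0 (lt0r_neq0 cl).
have [al [be [al0 be0 w1 ns1 ns2]]] := nonflat_mid (qt i) li c1 nsl.
move: w1 ns1 ns2; set w := _ + _ => w1 ns1 ns2.
have eqi : t i + vv i = q i by rewrite addrC subrK.
have eli : t i + (t l - t i) = t l by rewrite addrC subrK.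
have Cqi : C (t i + vv i) by rewrite eqi.
have Cli : C (t i + (t l - t i)) by rewrite eli.
have Cw : C (t i + w) := fanC c1 (Ct i) Cqi Cli (qt i) li w1 al0 be0 erefl.
have ezi : t i + w - t i = w by rewrite addrAC subrr add0r.
have cw : 0 < cr (- sg) (vv i) w by rewrite /w crDr !crZr crxx mulr0 add0r mulr_gt0.
exists (t i + w); last first.
  move=> c ci; rewrite ezi => sw.
  have ci0 : c != i by apply/eqP => e; apply: (@dist0F i); rewrite -{1}e.
  have := center_off_chord sg0 ci0; rewrite neq_lt => /orP[lt0|gt0].
    rewrite -oppr_gt0 -crN in lt0.
    have e := nbr_uniq (sg_opp sg0) ci li lt0 cl.
    by apply: ns2; rewrite -e; exact: same_faceC.
  have e := nbr_uniq sg0 ci tji gt0 cj; rewrite e in sw.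
  by apply: ns1; apply: (same_face_trans normN nangled (qt i) tji w1 sit); exact: same_faceC.
split=> //.
- by rewrite ezi.
- move=> c ci; rewrite lt_neqAle (Cd Cw (Ct c)) andbT; apply/eqP => wc.
  case: (spokeC (Ct i) Cqi Cli Cw (Ct c) (qt i) li c1 wc al0 be0 erefl).
  + by move=> /t_inj e; move: ci; rewrite e eqxx.
  + by rewrite eqi => -[_ _ /qpriv_eq e]; move: ci; rewrite e eqxx.
  + by rewrite ezi => -[_ s _].
move=> c ec; have ci : N (t c - t i) = 1 by rewrite -ec ezi.
have cwc : 0 < cr (- sg) (vv i) (t c - t i) by rewrite -ec ezi.
have e := nbr_uniq (sg_opp sg0) ci li cwc cl.
by apply: ns2; rewrite -e -ec ezi; exact: same_face_refl.
Qed.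

(** * Pieces between consecutive chords contain no diametral pair *)

Section NoFlatPair.
Hypothesis noflat : forall i j, ~ same_face (vv i) (t j - q j).

(** If [q i] and [q j] were at distance 1, their chord would cross the one from [t i] to [t j], but
    both points are strictly on one side of that line. *)
Lemma qq_lt sg i j : sg != 0 -> N (t j - t i) = 1 -> 0 < cr sg (vv i) (t j - t i) ->
  N (q i - q j) < 1.
Proof.
move=> sg0 tji c; rewrite lt_neqAle Cd// andbT; apply/eqP => qij.
have tij : N (t i - t j) = 1 by rewrite nrmC.
have cj := nbr_sym sg0 tji c.
case: (crossC (Cq i) (Cq j) (Ct j) (Ct i) qij tji).
- move=> s; have [_ _ s1 _] := rectC (Cq i) (Cq j) (Ct j) (Ct i) qij tji s.
  have [_ _ _ s2] := rectC (Cq i) (Cq j) (Ct j) (Ct i) qij tji s.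
  exact: noflat (same_face_trans normN nangled (qt i) qij (tq j) (same_faceC s1) s2).
- move=> s; have [h _ _ _] := rectC (Cq i) (Cq j) (Ct i) (Ct j) qij tij s.
  by apply: (@dist0F i); rewrite -{1}(qpriv_eq h).
move=> [s [ta [s0 s1 ta0 ta1 e]]].
have ci : cr sg (t j - t i) (q i - t i) < 0 by rewrite crC oppr_lt0.
have cj' : cr sg (t j - t i) (q j - t i) < 0.
  have -> : q j - t i = vv j + (t j - t i) by vec; ring.
  by rewrite crDr crxx addr0 crC oppr_lt0 -(opprB (t i) (t j)) crNr oppr_gt0.
have : cr sg (t j - t i) (q j + s *: (q i - q j) - t i) = 0.
  by rewrite e addrAC subrr add0r crZr crxx mulr0.
have -> : q j + s *: (q i - q j) - t i = (1 - s) *: (q j - t i) + s *: (q i - t i).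
  by vec; ring.
by rewrite [cr _ _ (_ *: _ + _)]crDr !crZr; nra.
Qed.

(** A diametral pair weakly on one side of a chord shares an endpoint or a face with it. Applied to
    both chords, this leaves only configurations excluded by [qq_lt], [noflat] and privacy. *)
Lemma piece_lt1 sg i j x x' : sg != 0 -> N (t j - t i) = 1 ->
  0 < cr sg (vv i) (t j - t i) -> C x -> C x' ->
  cr sg (vv i) (x - t i) <= 0 -> 0 <= cr sg (vv j) (x - t j) ->
  cr sg (vv i) (x' - t i) <= 0 -> 0 <= cr sg (vv j) (x' - t j) ->
  N (x - x') < 1.
Proof.
move=> sg0 tji c Cx Cx' xi xj xi' xj'; rewrite lt_neqAle Cd// andbT; apply/eqP => xx.
have qij := qq_lt sg0 tji c.
have cj := nbr_sym sg0 tji c.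
have ji : j != i by apply/eqP => e; apply: (@dist0F i); rewrite -{1}e.
have qne : q i <> q j by move=> e; move: (qpriv ji); rewrite e qt ltxx.
have side k s y y' : s != 0 -> C y -> C y' -> N (y - y') = 1 ->
    0 <= cr s (vv k) (y - t k) -> 0 <= cr s (vv k) (y' - t k) ->
    [\/ same_face (y - y') (vv k), same_face (y - y') (t k - q k) |
     (y = t k \/ y = q k) \/ (y' = t k \/ y' = q k)].
  move=> s0 Cy Cy' yy cy cy'; have y'y : N (y' - y) = 1 by rewrite nrmC.
  case: (crossC Cy Cy' (Cq k) (Ct k) yy (qt k)); [exact: Or31 | exact: Or32 |].
  move=> [r [ta [r0 r1 ta0 ta1 e]]].
  have : cr s (vv k) (y' + r *: (y - y') - t k) = 0.
    by rewrite e addrAC subrr add0r crZr crxx mulr0.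
  have -> : y' + r *: (y - y') - t k = (1 - r) *: (y' - t k) + r *: (y - t k).
    by vec; ring.
  rewrite [cr _ _ (_ *: _ + _)]crDr !crZr => h; apply: Or33.
  have [h0|h0] := eqVneq (cr s (vv k) (y - t k)) 0.
    by left; exact: (diametral_on_chord s0 Cy Cy' yy h0).
  right; apply: (diametral_on_chord s0 Cy' Cy y'y).
  have : 0 < cr s (vv k) (y - t k) by rewrite lt_def h0.
  nra.
have tin : forall y, cr sg (vv i) (y - t i) <= 0 -> 0 <= cr sg (vv j) (y - t j) ->
    y <> t i /\ y <> t j.
  move=> y yi yj; split=> e; first by move: yj; rewrite e leNgt cj.
  by move: yi; rewrite e leNgt c.
have [nxi nxj] := tin x xi xj; have [nxi' nxj'] := tin x' xi' xj'.
have xx' : N (x' - x) = 1 by rewrite nrmC.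
have flat y y' : C y -> C y' -> N (y - y') = 1 -> 0 <= cr sg (vv j) (y - t j) ->
    0 <= cr sg (vv j) (y' - t j) -> y <> t j -> y' <> t j -> same_face (y - y') (vv i) -> False.
  move=> Cy Cy' yy cy cy' ny ny' s.
  have [yti qy _ s2] := rectC Cy Cy' (Cq i) (Ct i) yy (qt i) s.
  case: (side j sg y y') => //.
  - move=> sj; have s3 := same_face_trans normN nangled (qt i) yy (qt j) (same_faceC s) sj.
    have [h _ _ _] := rectC (Cq i) (Ct i) (Cq j) (Ct j) (qt i) (qt j) s3.
    by move: ji; rewrite (qpriv_eq h) eqxx.
  - by move=> sj; exact: noflat (same_face_trans normN nangled (qt i) yy (tq j) (same_faceC s) sj).
  move=> [[//|e]|[//|e]].
    rewrite e in yti; by move: ji; rewrite (qpriv_eq yti) eqxx.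
  by move: qij; rewrite -e qy ltxx.
have endq y y' : C y' -> N (y - y') = 1 -> 0 <= cr sg (vv j) (y - t j) ->
    0 <= cr sg (vv j) (y' - t j) -> y' <> t j -> y = q i -> False.
  move=> Cy' yy cy cy' ny' ey; rewrite ey in yy cy.
  case: (side j sg (q i) y') => //.
  - move=> s; have [h _ _ _] := rectC (Cq i) Cy' (Cq j) (Ct j) yy (qt j) s.
    by move: ji; rewrite (qpriv_eq h) eqxx.
  - move=> s; have [h _ _ _] := rectC (Cq i) Cy' (Ct j) (Cq j) yy (tq j) s.
    by move: qij; rewrite h ltxx.
  move=> [[e|e]|[//|e]].
  - by apply: (@qoff i j).
  - exact: qne.
  - by move: qij; rewrite -e yy ltxx.
case: (side i (- sg) x x' (sg_opp sg0)) => //; rewrite ?crN ?oppr_ge0//.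
- exact: flat.
- by move=> s; apply: (flat x' x) => //; apply: same_faceN; rewrite // !opprB.
move=> [[//|e]|[//|e]].
- exact: (endq x x').
- exact: (endq x' x).
Qed.

End NoFlatPair.

(** * The cycle of left neighbors *)

Section Order.
Variable r : 'I_m -> 'I_m.
Hypothesis rt : forall i, N (t (r i) - t i) = 1.
Hypothesis rl : forall i, 0 < cr 1 (vv i) (t (r i) - t i).

Definition left_of c x : bool := 0 < cr 1 (vv c) (x - t c).

Lemma r_right i : cr 1 (vv (r i)) (t i - t (r i)) < 0.
Proof. by apply: nbr_sym (rt i) (rl i); exact: oner_neq0. Qed.

Lemma rt' i : N (t i - t (r i)) = 1. Proof. by rewrite nrmC. Qed.

Lemma r_neq i : r i != i.
Proof. by apply/eqP => e; have := rt i; rewrite e; exact: dist0F. Qed.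

(** Both preimages would be the neighbor on the right of the same center. *)
Lemma r_inj : injective r.
Proof.
move=> i j e; have N1 : -1 != 0 :> R by rewrite oppr_eq0 oner_eq0.
apply: (nbr_uniq N1 (rt' i)); rewrite ?crN ?oppr_gt0 ?r_right//.
  by rewrite e rt'.
by rewrite e r_right.
Qed.

Lemma left_of_flip c (a : 'I_m) : a != c -> r a != c -> left_of c (t (r a)) = ~~ left_of c (t a).
Proof.
move=> ac rac; have := opp_sides (oner_neq0 R) rac ac (rt a).
rewrite /left_of; have [c0|c0|<-] := ltgtP 0 (cr 1 (vv c) (t a - t c)) => h /=.
- by apply/negbTE; rewrite -leNgt; apply: ltW; rewrite -(pmulr_llt0 _ c0).
- by rewrite -(nmulr_llt0 _ c0).
- by move: h; rewrite mulr0 ltxx.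
Qed.

Lemma iter_neq c d : (0 < d < order r c)%N -> iter d r c != c.
Proof.
move=> /andP[d0 dc]; apply/eqP => e; have := findex_iter dc.
by rewrite e findex0 => d00; move: d0; rewrite -d00.
Qed.

(** [r c] is on the left of chord [c], and each further step crosses that chord until the orbit
    returns to [c]. *)
Lemma left_of_iter c d : (0 < d < order r c)%N -> left_of c (t (iter d r c)) = odd d.
Proof.
elim: d => [//|[_ _|d IH /andP[_ dc]]]; first by rewrite /left_of /= rl.
have dc' : (0 < d.+1 < order r c)%N by rewrite /= ltnW.
rewrite [iter _ _ _]/= left_of_flip; [by rewrite IH | exact: iter_neq dc' |].
by apply: (@iter_neq c d.+2).
Qed.

(* Going once around from [r c] back to [c] alternates between the sides of chord [c],
   starting on the left and ending on the right. *)
Lemma order_odd c : odd (order r c).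
Proof.
have o0 := order_gt0 r c; have e := iter_order r_inj c.
have o1 : order r c != 1%N.
  by apply/eqP => o1; move: e; rewrite o1 /=; apply/eqP; exact: r_neq.
have o2 : (0 < (order r c).-1 < order r c)%N by lia.
have ec : r (iter (order r c).-1 r c) = c by rewrite -iterS prednK.
have := left_of_iter o2; rewrite -{1}ec /left_of ltNge ltW ?r_right//=.
by lia.
Qed.

(* An orbit avoiding [c] alternates between the sides of chord [c] all the way around, so
   its length would be even. *)
Lemma fconnect_all c i : fconnect r i c.
Proof.
apply: contraT => nc; exfalso.
have ni d : iter d r i != c by apply: contraNneq nc => <-; exact: fconnect_iter.
have flip d : left_of c (t (iter d r i)) = odd d (+) left_of c (t i).
  elim: d => [//|d IH]; rewrite [iter _ _ _]/= left_of_flip ?IH//; last exact: (ni d.+1).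
  by rewrite /= addNb.
have := flip (order r i); rewrite iter_order ?order_odd; last exact: r_inj.
by case: (left_of c (t i)).
Qed.

Lemma order_m c : order r c = m.
Proof.
rewrite /order -[RHS]card_ord; apply: eq_card => i.
by rewrite !inE; exact: fconnect_all.
Qed.

Lemma iter_m c : iter m r c = c.
Proof. by have := iter_order r_inj c; rewrite order_m. Qed.

(** [A] and its image under [r] are disjoint and equally large. *)
Lemma indep_card (A : {set 'I_m}) :
  (forall a b : 'I_m, a \in A -> b \in A -> N (t a - t b) < 1) -> (2 * #|A| <= m)%N.
Proof.
move=> ind; have dis : #|A :&: r @: A| = 0%N.
  apply/eqP; rewrite cards_eq0; apply/eqP/finset.setP => a; rewrite !inE.
  apply/negbTE/andP => -[aA /imsetP[b bA e]].
  by have := ind _ _ aA bA; rewrite e rt ltxx.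
have := cardsUI A (r @: A); rewrite dis card_imset; last exact: r_inj.
have : (#|A :|: r @: A| <= m)%N by rewrite -[leqRHS]card_ord; exact: max_card.
by rewrite addn0 => h1 h2; rewrite mul2n -addnn -h2.
Qed.

(** * Sides of a diametral endpoint along the cycle *)

Section Word.
Variables (x y : 'rV[R]_2).
Hypotheses (Cx : C x) (Cy : C y) (xy : N (x - y) = 1).

Lemma same_side c z : 0 < cr 1 (vv c) (x - t c) * cr 1 (vv c) (z - t c) ->
  left_of c x = left_of c z.
Proof.
rewrite /left_of; have [c0|c0|<-] := ltgtP 0 (cr 1 (vv c) (x - t c)).
- by rewrite pmulr_rgt0.
- by rewrite nmulr_rgt0// => /ltW; rewrite leNgt => /negbTE.
- by rewrite mul0r ltxx.
Qed.

(* For [sg = 1] the gap lemmas apply to the pair [(c, r c)], for [sg = -1] to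
   [(r c, c)]; both reduce [left_of] at [x] to [left_of] at a center. *)
Lemma word_after c p : left_of c x = left_of (r c) x -> (0 < p <= m)%N ->
  left_of (iter p r c) x = odd (m - p + left_of c x).
Proof.
move=> e /andP[p0 pm]; have om : odd m by rewrite -(order_m c) order_odd.
have [->|pm'] := eqVneq p m; first by rewrite iter_m subnn; case: (left_of c x).
have [->|p1] := eqVneq p 1%N.
  by rewrite /= -e; case: (left_of c x); rewrite oddD oddB ?om//; lia.
have pc : iter p r c != c by apply: iter_neq; rewrite order_m; lia.
have prc : iter p r c != r c.
  have -> : iter p r c = r (iter p.-1 r c) by rewrite -iterS prednK.
  apply/eqP => /r_inj /eqP; apply/negP; apply: iter_neq; rewrite order_m; lia.
have ec : c = iter (m - p) r (iter p r c).
  by rewrite -iterD subnK// iter_m.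
case E : (left_of c x) e => /esym e.
  have erc : r c = iter (m - p + 1) r (iter p r c).
    by rewrite addnC iterD -ec.
  have N1 : -1 != 0 :> R by rewrite oppr_eq0 oner_eq0.
  have h1 : 0 < cr (-1) (vv (r c)) (t c - t (r c)) by rewrite crN oppr_gt0 r_right.
  have h2 : cr (-1) (vv (r c)) (x - t (r c)) <= 0 by rewrite crN oppr_le0 ltW.
  have h3 : cr (-1) (vv c) (x - t c) <= 0 by rewrite crN oppr_le0 ltW.
  have := gap_side N1 Cx Cy xy (rt' c) h1 h2 h3 prc pc.
  rewrite !crN mulrNN => /same_side ->.
  rewrite {1}erc left_of_iter// order_m; lia.
have h2 : cr 1 (vv c) (x - t c) <= 0 by rewrite leNgt; exact: negbT E.
have h3 : cr 1 (vv (r c)) (x - t (r c)) <= 0 by rewrite leNgt; exact: negbT e.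
have /same_side -> := gap_side (oner_neq0 R) Cx Cy xy (rt c) (rl c) h2 h3 pc prc.
have -> : t c = t (iter (m - p) r (iter p r c)) by rewrite -ec.
rewrite left_of_iter ?order_m ?addn0//; lia.
Qed.

Variable i0 : 'I_m.
Definition word p := left_of (iter p r i0) x.
Definition defect p := word p == word p.+1.

Lemma word_periodic p : word (p + m) = word p.
Proof. by rewrite /word iterD iter_m. Qed.

Lemma defect_periodic p : defect (p + m) = defect p.
Proof. by rewrite /defect -addSn !word_periodic. Qed.

(** After a defect, [word_after] makes the word alternate for a full period. *)
Lemma defect_gap p d : defect p -> (0 < d < m)%N -> ~~ defect (p + d).
Proof.
move=> /eqP e /andP[d0 dm].
have w k : (0 < k <= m)%N -> word (p + k) = odd (m - k + word p).
  by move=> km; rewrite /word addnC iterD; apply: word_after.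
by rewrite /defect -addnS !w; lia.
Qed.

Lemma defect_block s : (\sum_(p < m) defect (s + p) <= 1)%N.
Proof.
have [/existsP[p0 dp]|/existsPn nd] := boolP [exists p : 'I_m, defect (s + p)].
  rewrite (bigD1 p0)//= big1 ?addn0 ?leq_b1// => p pp.
  have := ltn_ord p; have := ltn_ord p0 => lt0 lt.
  apply/eqP; rewrite eqb0; have [lep|lep] := ltnP p0 p.
    have := @defect_gap _ (p - p0) dp; rewrite -addnA subnKC; last lia.
    by apply; lia.
  (* For [p] before [p0], go around the cycle and use periodicity. *)
  have := @defect_gap _ (m + p - p0) dp.
  have -> : (s + p0 + (m + p - p0) = s + p + m)%N by lia.
  rewrite defect_periodic; apply.
  have : (p : nat) <> p0 by move=> /val_inj h; move: pp; rewrite h eqxx.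
  lia.
by rewrite big1// => p _; apply/eqP; rewrite eqb0.
Qed.

Lemma defect_count c n : (n <= c * m)%N -> (\sum_(0 <= p < n) defect p <= c)%N.
Proof.
move=> nc; apply: (@leq_trans (\sum_(0 <= p < c * m) defect p)).
  by rewrite [leqRHS](big_cat_nat (n := n))//= leq_addr.
elim: c {n nc} => [|c IH]; first by rewrite mul0n big_geq.
rewrite (big_cat_nat (n := (c * m)%N))//=; last by rewrite leq_mul2r leqnSn orbT.
apply: (@leq_trans (c + 1)); last by rewrite addn1.
apply: leq_add => //; rewrite mulSn -{1}[(c * m)%N]add0n big_addn addnK big_mkord.
by apply: leq_trans (defect_block (c * m)); apply: leq_sum => p _; rewrite addnC.
Qed.

(* The two kinds of sign changes alternate, hence differ in number by
   [word 0 - word n]. *)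
Lemma word_count n : (n + word n =
  2 * (\sum_(0 <= p < n) (~~ word p && word p.+1)) + word 0 +
  \sum_(0 <= p < n) defect p)%N.
Proof.
elim: n => [|n IH]; first by rewrite !big_geq//; lia.
rewrite !big_nat_recr//=; move: IH; rewrite {3}/defect.
by case: (word n); case: (word n.+1) => /=; lia.
Qed.

(** At most [c] defects leave at least [2 * k - 1] for twice the number of changes from right to
    left, and parity yields [k]. *)
Lemma word_cover k c n : n = (2 * k + c)%N -> (n <= c * m)%N ->
  (k <= #|[pred p : 'I_n | ~~ word p && word p.+1]|)%N.
Proof.
move=> en nc; have := defect_count nc; have := word_count n.
have -> : #|[pred p : 'I_n | ~~ word p && word p.+1]| =
    (\sum_(p < n) (~~ word p && word p.+1))%N.
  by rewrite -sum1_card big_mkcond; apply: eq_bigr => p _; rewrite inE; case: (_ && _).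
by rewrite !big_mkord; have := leq_b1 (word 0); lia.
Qed.

End Word.

(** * The covering family and the incidence count *)

Lemma hull_compact (i : 'I_m) : compact C.
Proof.
have [K K0 NK] := mx_le_nrm normN.
apply: bounded_closed_compact.
  exists (K * (1 + N (t i))); split; [exact: num_real | move=> M MK x Cx].
  apply: le_trans (NK x) _; apply: le_trans (ltW MK); rewrite ler_pM2l//.
  have := nrmD normN (x - t i) (t i); rewrite subrK.
  have := Cd Cx (Ct i); lra.
have -> : C = \bigcap_(j in [set: 'I_m]) (fun x => N (x - t j)) @^-1` [set z | z <= 1].
  apply/seteqP; split => [x Cx j _|x h]; first exact: Cd.
  by apply: Cm => j; exact: (h j).
apply: closed_bigI => j _; apply: preimage_closed; last exact: closed_le.
move=> x _; apply: (lipschitz_continuous normN ltr01) => y z; rewrite mul1r ler_norml.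
have := nrmB normN (y - t j) (z - t j); have := nrmB normN (z - t j) (y - t j).
have e a b : a - t j - (b - t j) = a - b by vec; ring.
by rewrite !e; have := nrmC normN y z; lra.
Qed.

Lemma upper_cover (i : 'I_m) k c n : (forall i j, ~ same_face (vv i) (t j - q j)) ->
  n = (2 * k + c)%N -> (n <= c * m)%N ->
  exists2 F : 'I_n -> set 'rV[R]_2,
    forall p, F p `<=` C /\
      exists2 e, 0 < e & forall x x', F p x -> F p x' -> N (x - x') <= 1 - e &
    forall x, C x -> (k <= #|[pred p | x \in F p]|)%N.
Proof.
move=> noflat en nc; pose g l x := cr 1 (vv l) (x - t l).
have gc l : continuous (g l) by exact: (cr_continuous normN).
have gNc l : continuous (fun x => - g l x).
  rewrite (_ : (fun x => _) = (fun x => cr (-1) (vv l) (x - t l))).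
    exact: (cr_continuous normN).
  by apply: funext => x; rewrite /g crN.
(* The condition [h p <= 0] says: weakly right of the chord reached after [p] steps and weakly left
   of the next. *)
apply: (@thicken _ _ normN C Cd (hull_compact i) n k
  (fun p => g (iter p r i) \max (fun x => - g (iter p.+1 r i) x))); first lia.
- by move=> p; apply: max_fun_continuous; [exact: gc | exact: gNc].
- move=> p x x' Cx Cx'; rewrite /= !ge_max => /andP[x1 x2] /andP[x1' x2'].
  rewrite !oppr_le0 in x2 x2'.
  exact: (piece_lt1 noflat (oner_neq0 R) (rt (iter p r i)) (rl _) Cx Cx').
- move=> x y Cx Cy xy; apply: leq_trans (word_cover Cx Cy xy i en nc) _.
  apply: subset_leq_card; apply/fintype.subsetP => p; rewrite !inE /word /left_of => /andP[h1 h2].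
  by rewrite /= ge_max oppr_le0 leNgt h1 ltW.
Qed.

(** Count incidences between centers and members: each center is in at least [k] members, and each
    member contains at most [s] centers by [indep_card]. *)
Lemma lower_count s k n (F : 'I_n -> set 'rV[R]_2) : m = (2 * s + 1)%N ->
  (forall p x x', F p x -> F p x' -> N (x - x') < 1) ->
  (forall x, C x -> (k <= #|[pred p | x \in F p]|)%N) -> (k * m <= n * s)%N.
Proof.
move=> ms sep cov.
have -> : (k * m = \sum_(i < m) k)%N by rewrite sum_nat_const card_ord mulnC.
have -> : (n * s = \sum_(p < n) s)%N by rewrite sum_nat_const card_ord.
apply: (@leq_trans (\sum_(i < m) \sum_(p < n) (t i \in F p))).
  apply: leq_sum => i _; apply: leq_trans (cov _ (Ct i)) _.
  rewrite -sum1_card big_mkcond /=; apply: leq_sum => p _.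
  by rewrite inE; case: (_ \in _).
rewrite exchange_big /=; apply: leq_sum => p _.
pose A : {set 'I_m} := finset (fun i => t i \in F p).
have -> : (\sum_(i < m) (t i \in F p) = #|A|)%N.
  by rewrite -sum1_card [RHS]big_mkcond /=; apply: eq_bigr => i _; rewrite inE; case: (_ \in _).
have : (2 * #|A| <= m)%N.
  by apply: indep_card => a b; rewrite !finset.inE => /set_mem aF /set_mem bF; exact: (sep p).
lia.
Qed.

End Order.

End Body.

(** * Diameters, completeness and irredundant intersections *)

Section Diameter.
Variables (R : realType) (N : 'rV[R]_2 -> R).
Hypothesis normN : is_norm N.
Implicit Types (S : set 'rV[R]_2).

Lemma le_diameter S x y : S x -> S y -> ((N (x - y))%:E <= diameter N S)%E.
Proof.
move=> Sx Sy; rewrite /diameter le_max; apply/orP; right.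
by apply: ereal_sup_ubound; exists x => //; exists y.
Qed.

Lemma diameter_le S e : 0 <= e -> (forall x y, S x -> S y -> N (x - y) <= e) ->
  (diameter N S <= e%:E)%E.
Proof.
move=> e0 Se; rewrite /diameter ge_max lee_fin e0 /=.
by apply: ge_ereal_sup => _ [x Sx [y Sy <-]]; rewrite lee_fin Se.
Qed.

Lemma diameter_mono S S' : S `<=` S' -> (diameter N S <= diameter N S')%E.
Proof.
move=> SS'; rewrite /diameter ge_max !le_max lexx /=; apply/orP; right.
by apply: ereal_sup_le => _ [x Sx [y Sy <-]]; exists x; [exact: SS' | exists y; [exact: SS'|]].
Qed.

Lemma translate_diskP (t x : 'rV[R]_2) : translate t (unit_disk N) x <-> N (x - t) <= 1.
Proof.
rewrite /translate /unit_disk /closed_ball_ /=; split => [[y /= h <-]|h].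
  by rewrite addrAC subrr add0r -nrmN// -sub0r.
by exists (x - t); [rewrite /= sub0r nrmN | rewrite addrC subrK].
Qed.

(** Adding [z] would not change the diameter. *)
Lemma complete_ball_hull (C : set 'rV[R]_2) z : complete_set N C -> diameter N C = 1%:E ->
  (forall x, C x -> N (z - x) <= 1) -> C z.
Proof.
move=> [_ maxC] dC hz; apply: contrapT => nCz; apply: (maxC (C `|` [set z])).
  apply/eqP; rewrite eq_le (diameter_mono (@subsetUl _ _ _)) andbT dC.
  have Cd x y : C x -> C y -> N (x - y) <= 1.
    by move=> Cx Cy; rewrite -lee_fin -dC; exact: le_diameter.
  apply: diameter_le => // x y [Cx|->] [Cy|->].
  - exact: Cd.
  - by rewrite nrmC// hz.
  - exact: hz.
  - by rewrite subrr nrm0.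
by split; [move=> x; left | move=> /(_ z) h; apply: nCz; apply: h; right].
Qed.

Lemma diskP n (t : 'I_n -> 'rV[R]_2) z :
  (\bigcap_(i in [set: 'I_n]) translate (t i) (unit_disk N)) z <-> forall i, N (z - t i) <= 1.
Proof.
by split=> [h i|h i _]; [apply/translate_diskP; exact: h | apply/translate_diskP].
Qed.

(** Without such a point, the disk of [t i] could be dropped, and [lift i] reindexes the others. *)
Lemma irredundant_disks m (C : set 'rV[R]_2) (t : 'I_m -> 'rV[R]_2) (i : 'I_m) :
  C = \bigcap_(i in [set: 'I_m]) translate (t i) (unit_disk N) ->
  (forall n, disk_intersection N n C -> (m <= n)%N) ->
  exists p, (forall j, j != i -> N (p - t j) <= 1) /\ 1 < N (p - t i).
Proof.
case: m t i => [t []//|m t i eC minC]; apply: contrapT => /forallNP noext.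
suff /minC : disk_intersection N m C by rewrite ltnn.
exists (t \o lift i); rewrite {1}eC; apply/seteqP; split=> z.
  by move=> h j _; exact: h.
move=> h; apply/diskP => j; have [->|ji] := eqVneq j i; last first.
  by case: (unliftP i j) ji => [k -> _|->]; [apply/translate_diskP; exact: h | rewrite eqxx].
rewrite leNgt; apply/negP => zi; apply: (noext z); split=> // k ki.
by case: (unliftP i k) ki => [l -> _|->]; [apply/translate_diskP; exact: h | rewrite eqxx].
Qed.

End Diameter.

(** * Ceilings, and assembly of the theorem *)

Lemma ceil_divnat (k s : nat) : (0 < k)%N -> (0 < s)%N ->
  exists2 c, Num.ceil (k%:Q / s%:Q) = c%:Z & (k <= c * s < k + s)%N.
Proof.
move=> k0 s0; pose c := ((k + s.-1) %/ s)%N.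
have h : (k <= c * s < k + s)%N.
  have := divn_eq (k + s.-1) s; have := ltn_pmod (k + s.-1) s0; rewrite -/c; lia.
exists c => //; apply: Num.Theory.ceil_def; case/andP: h => h1 h2.
have sQ : 0 < s%:Q by rewrite ltr0z.
rewrite ltr_pdivlMr// ler_pdivrMr// -!intrM ltr_int ler_int.
by apply/andP; split; lia.
Qed.

Theorem theorem4 (R : realType) (N : 'rV[R]_2 -> R) (C : set 'rV[R]_2)
    (m : nat) (normN : is_norm N) (not_angledN : ~ angled N)
    (reuleauxC : sided_reuleaux_polygon N m C) :
  odd m /\
  (forall s : nat, m = (2 * s + 1)%N ->
   forall k : nat, (0 < k)%N ->
   exists2 n : nat, kfold_borsuk_number N k C n &
     n%:Z = (2 * k)%:Z + Num.ceil (k%:Q / s%:Q)).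
Proof.
case: reuleauxC => [[complC dC _] [[t eC] minC]].
have Cd x y : C x -> C y -> N (x - y) <= 1.
  by move=> Cx Cy; rewrite -lee_fin -dC; exact: le_diameter.
have Cm z : (forall i, N (z - t i) <= 1) -> C z by move=> h; rewrite eC; exact/diskP.
have Ct i : C (t i).
  apply: (complete_ball_hull normN complC dC) => x; rewrite eC => /(diskP normN)/(_ i).
  by rewrite nrmC.
(* With [m = 0], [C] would be the whole plane, which is unbounded. *)
have [i0 _] : exists i : 'I_m, true.
  case: m t eC Cm {minC Ct} => [t eC Cm|m t _ _]; last by exists ord0.
  exfalso; have e0 : const_mx 1 != 0 :> 'rV[R]_2.
    by apply/eqP => /rowP/(_ ord0); rewrite !mxE => /eqP; rewrite oner_eq0.
  have n0 := nrm_gt0 normN e0.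
  have CT z : C z by apply: Cm => -[].
  have := Cd _ _ (CT ((2 / N (const_mx 1)) *: const_mx 1)) (CT 0).
  rewrite subr0 nrmZp// ?divr_ge0 ?nrm_ge0// divfK ?gt_eqF//.
  by rewrite leNgt ltr1n.
have privT i : exists z, private N C t i z.
  have [p [pj pi]] := irredundant_disks normN i eC minC.
  exact: private_exists pi.
(* A good private point is chosen whenever there is one, so that [flat_good] excludes all flat
   pairs. *)
have qT i : exists z, private N C t i z /\
    ((exists2 z', private N C t i z' & good N t i z') -> good N t i z).
  have [[z pz gz]|ng] := pselect (exists2 z', private N C t i z' & good N t i z').
    by exists z.
  by have [z pz] := privT i; exists z; split.
have [q qP] := choice qT.
have Cq i : C (q i) by case: (qP i) => -[].
have qt i : N (q i - t i) = 1 by case: (qP i) => -[].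
have qpriv i j : j != i -> N (q i - t j) < 1 by case: (qP i) => -[_ _ + _] _; apply.
have qoff i : off_centers t (q i) by case: (qP i) => -[].
have noflat i j : ~ same_face N (q i - t i) (t j - q j).
  move=> s; have [ng gz] := flat_good normN not_angledN Cd Cm Ct Cq qt qpriv qoff s.
  by apply: ng; apply: (qP i).2.
have [r rP] := choice (fun i =>
  left_nbr normN not_angledN Cd Cm Ct Cq qt qpriv qoff i (oner_neq0 R)).
have rt i : N (t (r i) - t i) = 1 := (rP i).1.
have rl i : 0 < cr 1 (q i - t i) (t (r i) - t i) := (rP i).2.
have om : odd m.
  rewrite -(order_m normN not_angledN Cd Cm Ct Cq qt qpriv qoff rt rl i0).
  exact: (order_odd normN not_angledN Cd Cm Ct Cq qt qpriv qoff rt rl i0).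
split=> // s ms k k0.
have s0 : (0 < s)%N.
  rewrite lt0n; apply/eqP => s0; have m1 : m = 1%N by rewrite ms s0.
  have := r_neq normN rt i0; apply/negP; rewrite negbK; apply/eqP/val_inj.
  have := ltn_ord (r i0); have := ltn_ord i0; rewrite /=; lia.
have [c ec /andP[c1 c2]] := ceil_divnat k0 s0.
exists (2 * k + c)%N; last by rewrite ec PoszD.
split.
  (* The side condition [2 * k + c <= c * (2 * s + 1)] amounts to [k <= c * s]. *)
  have [|F F1 F2] := upper_cover normN not_angledN Cd Cm Ct Cq qt qpriv qoff rt rl i0
    noflat (erefl (2 * k + c)%N) (_ : _ <= c * m)%N; first by rewrite ms; nia.
  exists F; split=> // p; have [FC [e e0 Fe]] := F1 p; split=> //.
  (* The maximum with 0 covers an empty piece with [1 < e]. *)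
  rewrite dC; apply: (@le_lt_trans _ _ ((Num.max 0 (1 - e))%:E)).
    apply: diameter_le => [|x y Fx Fy]; first by rewrite le_max lexx.
    by rewrite le_max Fe// orbT.
  by rewrite lte_fin gt_max ltr01; lra.
move=> n [F [F1 F2]].
have sep p x x' : F p x -> F p x' -> N (x - x') < 1.
  move=> Fx Fx'; rewrite -lte_fin -dC; apply: le_lt_trans (F1 p).2.
  exact: le_diameter.
have := lower_count normN not_angledN Cd Cm Ct Cq qt qpriv qoff rt rl ms sep F2.
(* From [k * (2 * s + 1) <= n * s] and [c * s < k + s], a value [n < 2 * k + c] is impossible. *)
rewrite ms; nia.
Qed.
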